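(* Let $\eta>0$ and let $K=\frac{\pi}{2}\left(1+\frac{\sqrt 2}{2}\right)$. Let $u$ be any piecewise constant control with $\|u\|_{L^1}\le K$. Let $\Upsilon^u_t$ be the propagator of the perturbed quantum harmonic oscillator $\dot\psi=(A_\eta+u(t)B)\psi$. For $N\in\mathbf N$, let $X^u_{(N)}(t,0)$ be the propagator, from time $0$ to time $t$, of its Galerkin approximation of order $N$, namely $\dot x=(A_\eta^{(N)}+u(t)B^{(N)})x$. Then, for every integer $N\ge 3$, every $t\ge 0$ and every $j\in\{1,2,3\}$, $$\|\pi_N\Upsilon^u_t(\phi_j)-X^u_{(N)}(t,0)\phi_j\|\le \frac{2^{N-1}K^{N-1}}{(N-2)!}\sqrt{\frac{(2N-3)!}{(N-3)!}}.$$ In particular, for $N=420$, one has $\|\pi_N\Upsilon^u_t(\phi_j)-X^u_{(N)}(t,0)\phi_j\|\le 10^{-4}$ for every $t\ge0$ and $j=1,2,3$.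
   Context: Here $\mathbf N=\{1,2,3,\dots\}$ and $H=L^2(\mathbf R,\mathbf C)$, with Hilbert basis $(\phi_n)_{n\in\mathbf N}$ given by the Hermite functions (normalized eigenfunctions of $(-\Delta+x^2)/2$) with eigenvalues $\lambda_n=n-\frac12$. For $\eta\ge 0$, $A_\eta$ is the skew-adjoint operator diagonal in this basis with $A_\eta\phi_n=-i\lambda_n^\eta\phi_n$, where $\lambda_n^\eta=\lambda_n+\eta/\lambda_n$. The operator $B$ is the (essentially skew-adjoint) control operator, tri-diagonal in this basis, with $\langle\phi_{k-1},B\phi_k\rangle=-i\sqrt{k-1}$ (for $k\ge2$), $\langle\phi_{k+1},B\phi_k\rangle=-i\sqrt{k}$, and $\langle\phi_j,B\phi_k\rangle=0$ otherwise. For every $u\in\mathbf R$, $A_\eta+uB$ is essentially skew-adjoint. For a piecewise constant control $u=\sum_j u_j\chi_{(t_j,t_{j+1})}$ with $0=t_0\le t_1\le\dots$, $\Upsilon^u_t$ is the unitary propagator obtained by composing successively the unitary groups generated by (the closures of) $A_\eta+u_jB$, each applied for the duration of the corresponding interval, up to time $t$. The projection $\pi_N$ is $\pi_N\psi=\sum_{k\le N}\langle\phi_k,\psi\rangle\phi_k$, and $A_\eta^{(N)}=\pi_NA_\eta\pi_N$, $B^{(N)}=\pi_NB\pi_N$. The propagator of a time-dependent linear system $\dot x=M(t)x$ from time $s$ to time $t$ is the operator mapping $x(s)$ to $x(t)$. *)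

(* Defs.v *)
From HB Require Import structures.
From mathcomp Require Import all_boot all_order all_algebra.
From mathcomp Require Import generic_quotient ring_quotient.
From mathcomp Require Import all_classical all_reals all_analysis measurable_realfun.
From mathcomp Require Import complex.
From mathcomp Require Import ring lra.

Set Implicit Arguments.
Unset Strict Implicit.
Unset Printing Implicit Defensive.

Import Order.TTheory GRing.Theory Num.Theory.
Import numFieldNormedType.Exports.

Local Open Scope classical_set_scope.
Local Open Scope ring_scope.
Local Open Scope complex_scope.

Definition lebR (R : realType) : {measure set (measurableTypeR R) -> \bar R} :=
  @lebesgue_measure R.

Section L2fun.
Variable R : realType.
Implicit Types f g : measurableTypeR R -> R[i].
Local Notation Re := (@complex.Re R).
Local Notation Im := (@complex.Im R).

Definition L2pred : {pred (measurableTypeR R -> R[i])} := fun f =>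
  (Re \o f \in Lfun (lebR R) 2%:E) && (Im \o f \in Lfun (lebR R) 2%:E).

Record L2fun := MkL2fun {
  L2val :> measurableTypeR R -> R[i];
  L2valP : L2val \in L2pred }.

HB.instance Definition _ := [isSub for L2val].
HB.instance Definition _ := [Choice of L2fun by <:].

Lemma ReM (a b : R[i]) : Re (a * b) = Re a * Re b - Im a * Im b.
Proof. by case: a => ? ?; case: b. Qed.

Lemma ImM (a b : R[i]) : Im (a * b) = Re a * Im b + Im a * Re b.
Proof. by case: a => ? ?; case: b. Qed.

Lemma ReD (a b : R[i]) : Re (a + b) = Re a + Re b.
Proof. by case: a => ? ?; case: b. Qed.

Lemma ImD (a b : R[i]) : Im (a + b) = Im a + Im b.
Proof. by case: a => ? ?; case: b. Qed.

Let lee12 : (1 <= 2%:E :> \bar R)%E. Proof. by rewrite lee_fin ler1n. Qed.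

Let Lfun_lin a b (f g : measurableTypeR R -> R) :
  f \in Lfun (lebR R) 2%:E -> g \in Lfun (lebR R) 2%:E ->
  (fun x => a * f x + b * g x) \in Lfun (lebR R) 2%:E.
Proof.
have [L0 Lc] := Lfun_submod_closed (lebR R) lee12 => fL gL.
have gbL : b *: g + 0 \in Lfun (lebR R) 2%:E by exact: Lc.
have := Lc a _ _ fL gbL.
suff -> : a *: f + (b *: g + 0) = (fun x => a * f x + b * g x) by [].
by rewrite addr0.
Qed.

Let Lfun_ext (f g : measurableTypeR R -> R) : f =1 g ->
  f \in Lfun (lebR R) 2%:E -> g \in Lfun (lebR R) 2%:E.
Proof. by move=> /funext ->. Qed.

Lemma L2pred_submod_closed : submod_closed L2pred.
Proof.
have L0 : (fun=> 0) \in Lfun (lebR R) 2%:E.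
  by have [] := Lfun_submod_closed (lebR R) lee12.
split; first by apply/andP; split; exact: Lfun_ext L0.
move=> a f g /andP[fr fi] /andP[gr gi]; apply/andP; split.
- apply: Lfun_ext (Lfun_lin 1 1 (Lfun_lin (Re a) (- Im a) fr fi) gr) => x.
  by rewrite !mul1r mulNr /= -ReM -ReD.
- apply: Lfun_ext (Lfun_lin 1 1 (Lfun_lin (Re a) (Im a) fi fr) gi) => x.
  by rewrite !mul1r /= -ImM -ImD.
Qed.

HB.instance Definition _ :=
  GRing.isSubmodClosed.Build R[i] _ L2pred L2pred_submod_closed.
HB.instance Definition _ := [SubChoice_isSubLmodule of L2fun by <:].

Definition Cintegral (h : R -> R[i]) : R[i] :=
  (\int[lebR R]_x Re (h x))%R +i* (\int[lebR R]_x Im (h x))%R.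

(* Antilinear in the first argument. *)
Definition innerfun (f g : R -> R[i]) : R[i] :=
  Cintegral (fun x => (f x)^* * g x).

Let Reip (a b : R[i]) : Re (a^* * b) = Re a * Re b + Im a * Im b.
Proof. by case: a => ? ?; case: b => ? ? /=; rewrite mulNr opprK. Qed.

Let mul_int (f g : measurableTypeR R -> R) : f \in Lfun (lebR R) 2%:E ->
  g \in Lfun (lebR R) 2%:E ->
  (lebR R).-integrable setT (fun x => (f x * g x)%:E).
Proof. by move=> fL gL; apply/Lfun1_integrable; exact: Lfun2_mul_Lfun1. Qed.

Implicit Types F G : L2fun.

Let Re_int F G :
  (lebR R).-integrable setT (EFin \o (fun x => Re ((F x)^* * G x))).
Proof.
have /andP[Fr Fi] := L2valP F; have /andP[Gr Gi] := L2valP G.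
apply: (@eq_integrable _ _ _ _ _ measurableT (fun x =>
  ((Re (F x) * Re (G x))%:E + (Im (F x) * Im (G x))%:E)%E)).
  by move=> x _; rewrite -EFinD /= Reip.
by apply: integrableD => //; exact: mul_int.
Qed.

Let B F G := Re (innerfun F G).

Let BE F G : B F G = (\int[lebR R]_x Re ((F x)^* * G x))%R. Proof. by []. Qed.

Let BC F G : B F G = B G F.
Proof.
rewrite !BE; congr fine; apply: eq_integral => x _.
by rewrite !Reip mulrC [X in _ + X]mulrC.
Qed.

Let BDl F1 F2 G : B (F1 + F2) G = B F1 G + B F2 G.
Proof.
rewrite !BE -RintegralD//; congr fine; apply: eq_integral => x _ /=.
by rewrite !Reip ReD ImD !mulrDl addrACA.
Qed.

Let BDr F1 F2 G : B G (F1 + F2) = B G F1 + B G F2.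
Proof. by rewrite BC BDl !(BC G). Qed.

Let BZl (a : R) F G : B (a%:C *: F) G = a * B F G.
Proof.
rewrite !BE -RintegralZl//; congr fine; apply: eq_integral => x _ /=.
by rewrite !Reip ReM ImM /= !mul0r subr0 addr0 mulrDr !mulrA.
Qed.

Let BZr (a : R) F G : B G (a%:C *: F) = a * B G F.
Proof. by rewrite BC BZl BC. Qed.

Let BZ (a : R[i]) F : B (a *: F) (a *: F) = (Re a ^+ 2 + Im a ^+ 2) * B F F.
Proof.
rewrite !BE -RintegralZl//; congr fine; apply: eq_integral => x _ /=.
by rewrite !Reip ReM ImM /=; congr EFin; ring.
Qed.

Let B_ge0 F : 0 <= B F F.
Proof.
by apply: Rintegral_ge0 => x _; rewrite Reip addr_ge0// -expr2 sqr_ge0.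
Qed.

Let CS F G : B F G ^+ 2 <= B F F * B G G.
Proof.
have H t : 0 <= B F F + 2 * t * B F G + t ^+ 2 * B G G.
  have := B_ge0 (F + t%:C *: G).
  by rewrite BDl !BDr !BZl !BZr (BC G F); congr (_ <= _); ring.
have [G0|G0] := eqVneq (B G G) 0.
  have [->|b0] := eqVneq (B F G) 0; first by rewrite expr0n/= G0 mulr0.
  have := H (- (B F F + 1) / (2 * B F G)).
  rewrite G0 mulr0 addr0.
  have -> : B F F + 2 * (- (B F F + 1) / (2 * B F G)) * B F G = -1.
    by field.
  by rewrite oppr_ge0 ler10.
have Gp : 0 < B G G by rewrite lt_def G0 B_ge0.
have := H (- B F G / B G G).
have -> : B F F + 2 * (- B F G / B G G) * B F G +
    (- B F G / B G G) ^+ 2 * B G G = (B F F * B G G - B F G ^+ 2) / B G G.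
  by field.
by rewrite pmulr_lge0 ?invr_gt0// subr_ge0.
Qed.

Let normfun F := Num.sqrt (B F F).

Let ler_normfunD F G : normfun (F + G) <= normfun F + normfun G.
Proof.
rewrite -(@ler_pXn2r _ 2)// ?nnegrE ?addr_ge0 ?sqrtr_ge0//.
rewrite sqrrD !sqr_sqrtr ?B_ge0// BDl !BDr (BC G F).
suff : B F G <= normfun F * normfun G by rewrite mulr2n; lra.
rewrite -sqrtrM ?B_ge0// (le_trans (ler_norm _))// -sqrtr_sqr.
by rewrite ler_sqrt ?CS// mulr_ge0 ?B_ge0.
Qed.

Let normfunZ (a : R[i]) F : normfun (a *: F) = Re `|a| * normfun F.
Proof.
by rewrite /normfun BZ sqrtrM ?addr_ge0 ?sqr_ge0//; case: a.
Qed.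

Let Im_int F G :
  (lebR R).-integrable setT (EFin \o (fun x => Im ((F x)^* * G x))).
Proof.
have -> : EFin \o (fun x => Im ((F x)^* * G x)) =
    EFin \o (fun x => Re ((F x)^* * (- 'i *: G) x)).
  by apply/funext => x /=; congr EFin; rewrite !(ReM, ImM)/=; ring.
exact: Re_int.
Qed.

Definition nullL2 : {pred L2fun} := fun F =>
  `[< {ae lebR R, forall x, F x = 0} >].

Lemma nullL2_zmod_closed : zmod_closed nullL2.
Proof.
split; first by apply/asboolP; apply: aeW.
move=> F G /asboolP F0 /asboolP G0; apply/asboolP.
by apply: filterS2 F0 G0 => x Fx Gx;
  rewrite -[LHS]/(F x - G x) Fx Gx subrr.
Qed.
HB.instance Definition _ :=
  GRing.isZmodClosed.Build L2fun nullL2 nullL2_zmod_closed.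

Let nullL2Z (a : R[i]) F : F \in nullL2 -> a *: F \in nullL2.
Proof.
move=> /asboolP F0; apply/asboolP; apply: filterS F0 => x Fx.
by rewrite -[LHS]/(a * F x) Fx mulr0.
Qed.

Let B_eq0 F : B F F = 0 -> F \in nullL2.
Proof.
move=> F0; apply/asboolP.
have /integrableP[mF _] := Re_int F F.
have I0 : (\int[lebR R]_x `|(Re ((F x)^* * F x))%:E| = 0)%E.
  under eq_integral => x _.
    rewrite /= ger0_norm ?Reip ?addr_ge0 -?expr2 ?sqr_ge0//.
    rewrite !expr2 -Reip; over.
  rewrite -[LHS]fineK; last exact: integrable_fin_num (Re_int F F).
  by rewrite -[fine _]/(B F F) F0.
have [+ _] := ae_eq_integral_abs (lebR R) measurableT mF.
move=> /(_ I0); apply: filterS => x /(_ I) /= -[].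
rewrite Reip -!expr2 => /eqP; rewrite paddr_eq0 ?sqr_ge0// !sqrf_eq0.
by move=> /andP[/eqP r0 /eqP i0]; apply/eqP; rewrite eq_complex r0 i0 !eqxx.
Qed.

Let innerfun_null F F' G G' : F - F' \in nullL2 -> G - G' \in nullL2 ->
  innerfun F G = innerfun F' G'.
Proof.
move=> /asboolP FF /asboolP GG.
have E : {ae lebR R, forall x, (F x)^* * G x = (F' x)^* * G' x}.
  apply: filterS2 FF GG => x /eqP + /eqP.
  rewrite -[X in X == _ -> _]/(F x - F' x) -[X in _ -> X == _ -> _]/(G x - G' x).
  by rewrite !subr_eq0 => /eqP -> /eqP ->.
rewrite /innerfun /Cintegral; congr (_ +i* _); congr fine.
- apply: ae_eq_integral => //.
  + by have /integrableP[] := Re_int F G.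
  + by have /integrableP[] := Re_int F' G'.
  + by apply: filterS E => x /= -> _.
- apply: ae_eq_integral => //.
  + by have /integrableP[] := Im_int F G.
  + by have /integrableP[] := Im_int F' G'.
  + by apply: filterS E => x /= -> _.
Qed.

Definition L2 : Type := Quotient.quot nullL2.
HB.instance Definition _ := GRing.Zmodule.on L2.
HB.instance Definition _ := EqQuotient.on L2.

Definition toL2 (F : L2fun) : L2 := \pi_L2%qT F.

Definition innerL2 (u v : L2) : R[i] := innerfun (repr u) (repr v).

Let scaleL2 (a : R[i]) (u : L2) : L2 := toL2 (a *: repr u).

Let toL2_eq F G : F - G \in nullL2 -> toL2 F = toL2 G.
Proof. by rewrite Quotient.idealrBE => /eqP. Qed.

Let repr_toL2 F : repr (toL2 F) - F \in nullL2.
Proof. by rewrite Quotient.idealrBE reprK. Qed.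

Let toL2D F G : toL2 (F + G) = toL2 F + toL2 G.
Proof. by rewrite /toL2 raddfD. Qed.

Let toL2Z a F : scaleL2 a (toL2 F) = toL2 (a *: F).
Proof.
by apply: toL2_eq; rewrite -scalerBr; apply: nullL2Z; exact: repr_toL2.
Qed.

Let toL2K u : toL2 (repr u) = u. Proof. exact: reprK. Qed.

Let scaleL2A a b u : scaleL2 a (scaleL2 b u) = scaleL2 (a * b) u.
Proof. by rewrite -(toL2K u) !toL2Z scalerA. Qed.

Let scale1L2 : left_id 1 scaleL2.
Proof. by move=> u; rewrite -(toL2K u) toL2Z scale1r. Qed.

Let scaleL2Dr : right_distributive scaleL2 +%R.
Proof.
by move=> a u v; rewrite -(toL2K u) -(toL2K v) -toL2D !toL2Z -toL2D scalerDr.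
Qed.

Let scaleL2Dl u : {morph scaleL2^~ u : a b / a + b}.
Proof. by move=> a b; rewrite -(toL2K u) !toL2Z -toL2D scalerDl. Qed.

HB.instance Definition _ := GRing.Zmodule_isLmodule.Build R[i] L2
  scaleL2A scale1L2 scaleL2Dr scaleL2Dl.

Lemma innerL2E F G : innerL2 (toL2 F) (toL2 G) = innerfun F G.
Proof. by apply: innerfun_null; exact: repr_toL2. Qed.

Let normL2 (u : L2) : R[i] := (Num.sqrt (Re (innerL2 u u)))%:C.

Let normL2E F : normL2 (toL2 F) = (normfun F)%:C.
Proof. by rewrite /normL2 innerL2E. Qed.

Let ler_normL2D u v : normL2 (u + v) <= normL2 u + normL2 v.
Proof.
rewrite -(toL2K u) -(toL2K v) -toL2D !normL2E -rmorphD lecR.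
exact: ler_normfunD.
Qed.

Let normL2Z a u : normL2 (a *: u) = `|a| * normL2 u.
Proof.
by rewrite -(toL2K u) [_ *: _]toL2Z !normL2E normfunZ rmorphM; congr (_ * _).
Qed.

Let normL2_eq0 u : normL2 u = 0 -> u = 0.
Proof.
rewrite -(toL2K u) normL2E => /eqP; rewrite eq_complex /= eqxx andbT.
rewrite sqrtr_eq0 => B0; have <- : toL2 0 = 0 by rewrite /toL2 raddf0.
apply: toL2_eq.
by rewrite subr0; apply: B_eq0; apply/eqP; rewrite eq_le B0 B_ge0.
Qed.

HB.instance Definition _ := Lmodule_isNormed.Build R[i] L2
  ler_normL2D normL2Z normL2_eq0.

Lemma normL2_inner (u : L2) : `|u| = (Num.sqrt (Re (innerL2 u u)))%:C.
Proof. by []. Qed.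

End L2fun.

Section Hermite.
Variable R : realType.
Implicit Types (x : R) (p : {poly R}).

(* Physicists' normalization, H_1 = 2X. *)
Fixpoint hermite (n : nat) : {poly R} :=
  if n is m.+1 then 2%:P * 'X * hermite m - (hermite m)^`() else 1.

Definition hermite_fun (n : nat) x : R :=
  (Num.sqrt (2 ^+ n * n`!%:R * Num.sqrt pi))^-1 *
  (hermite n).[x] * expR (- x ^+ 2 / 2).

Let poly_bound p (e : R) : 0 < e ->
  exists2 C : R, 0 <= C & forall x, p.[x] ^+ 2 <= C * expR (e * x ^+ 2).
Proof.
elim/poly_ind: p e => [|p c IH] e e0.
  by exists 0 => // x; rewrite horner0 expr0n/= mul0r.
have e20 : 0 < e / 2 by rewrite divr_gt0.
have [C C0 pC] := IH _ e20.
have D0 : 0 <= (e / 2)^-1 by rewrite invr_ge0 ltW.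
exists (2 * (C * (e / 2)^-1) + 2 * c ^+ 2).
  by apply: addr_ge0; do ?[exact: sqr_ge0 | apply: mulr_ge0].
move=> x; rewrite hornerMXaddC.
set E := expR (e / 2 * x ^+ 2).
have E1 : 1 <= E by rewrite -expR0 ler_expR mulr_ge0 ?sqr_ge0 ?(ltW e20).
have xE : x ^+ 2 <= (e / 2)^-1 * E.
  rewrite mulrC ler_pdivlMr// mulrC.
  by rewrite (le_trans _ (expR_ge1Dx _))// lerDr.
have -> : expR (e * x ^+ 2) = E * E by rewrite -expRD; congr expR; lra.
have pxE : p.[x] ^+ 2 * x ^+ 2 <= (C * E) * ((e / 2)^-1 * E).
  by rewrite ler_pM ?sqr_ge0.
have cE : c ^+ 2 <= c ^+ 2 * (E * E).
  by rewrite ler_peMr ?sqr_ge0// -[leLHS]mulr1 ler_pM.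
have := sqr_ge0 (p.[x] * x - c); move: pxE cE.
rewrite -exprMn sqrrB sqrrD.
set a := (p.[x] * x) ^+ 2; set b := p.[x] * x * c.
set d := (e / 2)^-1; rewrite !mulr2n; nra.
Qed.

Lemma measurable_hermite_fun n : measurable_fun [set: R] (hermite_fun n).
Proof.
apply: measurable_funM.
  by apply: measurable_funM => //; exact: measurable_poly.
apply: measurableT_comp => //; apply: measurable_funM => //.
by apply: measurableT_comp => //; exact: measurable_funX.
Qed.

Lemma hermite_fun_Lfun n : hermite_fun n \in Lfun (lebR R) 2%:E.
Proof.
have mh := measurable_hermite_fun n.
rewrite inE; apply/andP; split; first by rewrite inE.
rewrite inE/= /finite_norm unlock/=; apply: poweR_lty.
pose k := (Num.sqrt (2 ^+ n * n`!%:R * Num.sqrt (pi : R)))^-1.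
have h2 : (0 : R) < 2^-1 by [].
have [C C0 hC] := poly_bound (hermite n) h2.
pose M := k ^+ 2 * C * (normal_peak 1)^-1.
have pk : 0 < normal_peak (1 : R) by rewrite normal_peak_gt0// oner_eq0.
apply: (@le_lt_trans _ _ (\int[lebR R]_x (M * normal_pdf 0 1 x)%:E)%E).
  apply: ge0_le_integral => //.
  - apply/measurable_EFinP => /=.
    apply: (@measurableT_comp _ _ _ _ _ _ (fun x : R => x `^ 2)) => //.
    exact: measurableT_comp.
  - apply/measurable_EFinP; apply: measurable_funM => //.
    exact: measurable_normal_pdf.
  move=> x _ /=; rewrite lee_fin powR_mulrn// real_normK ?num_real//.
  rewrite normal_pdfE ?oner_eq0// /= /normal_fun subr0 expr1n.
  rewrite /M mulrA divfK ?gt_eqF// /hermite_fun -/k !exprMn.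
  rewrite -(mulrA (k ^+ 2) C) -(mulrA (k ^+ 2)) ler_wpM2l ?sqr_ge0//.
  rewrite -expRM_natl.
  apply: le_trans (ler_wpM2r (expR_ge0 _) (hC x)) _.
  by rewrite -mulrA -expRD ler_wpM2l// ler_expR; lra.
under eq_integral do rewrite EFinM.
rewrite integralZl//; last exact: integrable_normal_pdf.
by rewrite integral_normal_pdf mule1 ltry.
Qed.

Lemma hermite_L2pred n : (fun x => (hermite_fun n x)%:C) \in @L2pred R.
Proof.
apply/andP; split; first exact: hermite_fun_Lfun.
have [+ _] := Lfun_submod_closed (lebR R) (lee1n 2).
by [].
Qed.
End Hermite.

Section Oscillator.
Variable R : realType.
Local Notation C := R[i].
Local Notation H := (L2 R).
Implicit Types (eta u : R) (n k N : nat).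

(* Indexed from 1; the value at 0 is junk and is only ever used with the
   coefficient 0. *)
Definition phi n : H := toL2 (MkL2fun (hermite_L2pred R n.-1)).

Definition lambda_eta eta k : R :=
  let l := k%:R - 2^-1 in l + eta / l.

(* Unbounded operators on H are represented by their graphs. *)

(* The diagonal operator on its maximal domain, on which it is skew-adjoint. *)
Definition opA eta : set (H * H) :=
  [set p | forall k, (1 <= k)%N ->
     innerL2 (phi k) p.2 = - 'i * (lambda_eta eta k)%:C * innerL2 (phi k) p.1].

Definition Bphi k : H :=
  (- 'i * (Num.sqrt k.-1%:R)%:C) *: phi k.-1 +
  (- 'i * (Num.sqrt k%:R)%:C) *: phi k.+1.

(* B on the linear span of the basis, on which it is essentially skew-adjoint;
   its domain being that of A + uB, only the closures of the latter matter. *)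
Definition opB : set (H * H) :=
  [set p | exists n (c : nat -> C),
     p = (\sum_(1 <= k < n.+1) c k *: phi k,
          \sum_(1 <= k < n.+1) c k *: Bphi k)].

(* S + uT, on the intersection of the domains of S and T. *)
Definition perturb (S T : set (H * H)) u : set (H * H) :=
  [set p | exists v w, [/\ S (p.1, v), T (p.1, w) & p.2 = v + u%:C *: w]].

Definition derivative_at (x : R -> H) (t : R) (y : H) : Prop :=
  (h^-1)%:C *: (x (t + h) - x t) @[h --> 0^'] --> y.

Definition unitary_group (U : R -> H -> H) : Prop :=
  [/\ forall t (a : C) v w, U t (a *: v + w) = a *: U t v + U t w,
      forall t v w, innerL2 (U t v) (U t w) = innerL2 v w,
      forall v, U 0 v = v,
      forall s t v, U (s + t) v = U s (U t v) &
      forall v, continuous (U^~ v)].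

Definition generator (U : R -> H -> H) : set (H * H) :=
  [set p | derivative_at (U^~ p.1) 0 p.2].

(* The sum of the a j * \1_(tau j, tau j.+1); a finite sum is the case where
   a j = 0 for j large. *)
Definition pwc_control (tau a : nat -> R) (t : R) : R :=
  limn (series (fun j => a j * \1_(`]tau j, tau j.+1[) t)).

(* On [tau j, tau j.+1] the propagator is continued by the unitary group that
   the closure of A + (a j) B generates; this determines Y t for t in
   [0, sup tau[. *)
Definition schrodinger_propagator eta (tau a : nat -> R)
    (Y : R -> H -> H) : Prop :=
  (forall v, Y 0 v = v) /\
  forall j, exists U, [/\ unitary_group U,
    generator U = closure (perturb (opA eta) opB (a j)) &
    forall t v, tau j <= t <= tau j.+1 -> Y t v = U (t - tau j) (Y (tau j) v)].

Definition projN N (v : H) : H := \sum_(1 <= k < N.+1) innerL2 (phi k) v *: phi k.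

Definition compress N (S : set (H * H)) : set (H * H) :=
  [set p | exists2 w, S (projN N p.1, w) & p.2 = projN N w].

Definition galerkin_system eta N (u : R -> R) (t : R) : set (H * H) :=
  perturb (compress N (opA eta)) (compress N opB) (u t).

(* Solutions on [0, +oo[ of x' = M(t)x, the equation holding away from the set
   D of times where M may jump. *)
Definition solution (M : R -> set (H * H)) (D : set R) (x : R -> H) : Prop :=
  {within `[0, +oo[, continuous x} /\
  forall t, 0 < t -> ~ D t -> exists2 y, M t (x t, y) & derivative_at x t y.

(* X t s maps the value at time s of a solution to its value at time t, a
   solution being determined by its value at s. *)
Definition linear_propagator (M : R -> set (H * H)) (D : set R)
    (X : R -> R -> H -> H) : Prop :=
  forall s v, 0 <= s -> X s s v = v /\ solution M D (fun t => X t s v).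

End Oscillator.

(* Main.v *)
Require Import Defs.
From mathcomp Require Import all_boot all_order all_algebra.
From mathcomp Require Import generic_quotient.
From mathcomp Require Import all_classical all_reals all_analysis.
From mathcomp Require Import measurable_realfun.
From mathcomp Require Import complex.
From mathcomp Require Import zify ring lra.
Import Order.TTheory GRing.Theory Num.Theory.
Import numFieldNormedType.Exports.
Import Defs.
Local Open Scope classical_set_scope.
Local Open Scope ring_scope.
Local Open Scope complex_scope.

Set Implicit Arguments.
Unset Strict Implicit.
Unset Printing Implicit Defensive.

(** Write [c_k] for the coefficients of the solution [psi] of the Schroedinger
    equation in the Hermite basis and [T_n] for the distance from [psi] to the
    span of the first [n] Hermite functions.  The Hamiltonian is hermitian and
    tri-diagonal, so the spans of neighbouring basis vectors exchange mass only
    through the coupling [sqrt n * u] of [c_n] with [c_(n+1)]: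
    [(T_n ^ 2)' <= 2 * |u| * sqrt n * |c_n| * |c_(n+1)|], whence
    [T_n' <= |u| * sqrt n * T_(n-1)].  The eigenvalues drop out.  As [T_2 <= 1],
    and as [T_n] vanishes at time 0 for every [n >= 3] when the initial state is
    one of the first three basis vectors, integrating with respect to
    [V t], the integral of [|u|] up to [t], gives by induction
    [T_n <= sqrt (n! / 2) / (n - 2)! * V ^ (n - 2)] ([tail_growth]).

    The projected solution and the Galerkin solution obey the same equations for
    the coefficients up to [N], except that the former is driven by [c_(N+1)].
    The same balance shows that the norm [E] of their difference satisfies
    [E' <= |u| * sqrt N * T_N], and one more integration
    ([galerkin_error_growth]) yields
    [E <= sqrt N * sqrt (N! / 2) / ((N - 2)! * (N - 1)) * V ^ (N - 1)], which is
    below the announced bound since [n! * k! <= (n + k)!].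

    The coefficients of [psi] are differentiable whether or not [psi] lies in
    the domain of the generator, because
    [<phi_k, U_t w> = <U_(-t) phi_k, w>] and every [phi_k] is in that domain
    ([unitary_coef_ode]).  Only the orthonormality of the Hermite functions
    ([innerL2_phi]) enters: the lower bound on [T_n] is Bessel's inequality
    ([tail_ge0]). *)

(** * The inner product of L2 *)

#[local] Arguments innerL2 : simpl never.

Section InnerProduct.
Variable R : realType.
Local Notation H := (L2 R).
Local Notation Re := (@complex.Re R).
Local Notation Im := (@complex.Im R).
Implicit Types (F G : L2fun R) (u v w : H) (a : R[i]).

Lemma Re_conjM (z w : R[i]) : Re (z^* * w) = Re z * Re w + Im z * Im w.
Proof. by case: z => ? ?; case: w => ? ? /=; rewrite mulNr opprK. Qed.

Lemma Im_conjM (z w : R[i]) : Im (z^* * w) = Re z * Im w - Im z * Re w.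
Proof. by case: z => ? ?; case: w => ? ? /=; rewrite mulNr. Qed.

Lemma integrable_mul_L2 (f g : measurableTypeR R -> R) :
  f \in Lfun (lebR R) 2%:E -> g \in Lfun (lebR R) 2%:E ->
  (lebR R).-integrable setT (EFin \o (fun x => f x * g x)).
Proof. by move=> fL gL; apply/Lfun1_integrable; exact: Lfun2_mul_Lfun1. Qed.

Lemma integrable_Re_conjM F G :
  (lebR R).-integrable setT (EFin \o (fun x => Re ((F x)^* * G x))).
Proof.
have /andP[Fr Fi] := L2valP F; have /andP[Gr Gi] := L2valP G.
apply: (@eq_integrable _ _ _ _ _ measurableT (fun x =>
  ((Re (F x) * Re (G x))%:E + (Im (F x) * Im (G x))%:E)%E)).
  by move=> x _; rewrite -EFinD /= Re_conjM.
by apply: integrableD => //; exact: integrable_mul_L2.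
Qed.

Lemma integrable_Im_conjM F G :
  (lebR R).-integrable setT (EFin \o (fun x => Im ((F x)^* * G x))).
Proof.
have /andP[Fr Fi] := L2valP F; have /andP[Gr Gi] := L2valP G.
apply: (@eq_integrable _ _ _ _ _ measurableT (fun x =>
  ((Re (F x) * Im (G x))%:E - (Im (F x) * Re (G x))%:E)%E)).
  by move=> x _; rewrite -EFinB /= Im_conjM.
by apply: integrableB => //; exact: integrable_mul_L2.
Qed.

Lemma toL2_repr u : toL2 (repr u) = u. Proof. exact: reprK. Qed.

Lemma innerL2Dr u v w : innerL2 u (v + w) = innerL2 u v + innerL2 u w.
Proof.
have E : v + w = toL2 (repr v + repr w).
  by rewrite /toL2 raddfD /= !reprK.
rewrite E -{1}(toL2_repr u) innerL2E /innerL2 /innerfun /Cintegral.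
apply/eqP; rewrite eq_complex /=; apply/andP; split; apply/eqP.
- rewrite -RintegralD//; [|exact: integrable_Re_conjM..].
  congr fine; apply: eq_integral => x _ /=.
  by rewrite !Re_conjM ReD ImD; congr EFin; ring.
- rewrite -RintegralD//; [|exact: integrable_Im_conjM..].
  congr fine; apply: eq_integral => x _ /=.
  by rewrite !Im_conjM ReD ImD; congr EFin; ring.
Qed.

Lemma innerL2Zr a u v : innerL2 u (a *: v) = a * innerL2 u v.
Proof.
have E : a *: v = toL2 (a *: repr v) by [].
rewrite E -{1}(toL2_repr u) innerL2E /innerL2 /innerfun /Cintegral.
apply/eqP; rewrite eq_complex ReM ImM /=; apply/andP; split; apply/eqP.
- rewrite -!RintegralZl//;
    do ?[exact: integrable_Re_conjM|exact: integrable_Im_conjM].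
  rewrite -RintegralB//; last 2 first.
  + exact: (integrableZl measurableT _ (integrable_Re_conjM _ _)).
  + exact: (integrableZl measurableT _ (integrable_Im_conjM _ _)).
  congr fine; apply: eq_integral => x _ /=.
  by rewrite !Re_conjM !Im_conjM ReM ImM; congr EFin; ring.
- rewrite -!RintegralZl//;
    do ?[exact: integrable_Re_conjM|exact: integrable_Im_conjM].
  rewrite -RintegralD//; last 2 first.
  + exact: (integrableZl measurableT _ (integrable_Im_conjM _ _)).
  + exact: (integrableZl measurableT _ (integrable_Re_conjM _ _)).
  congr fine; apply: eq_integral => x _ /=.
  by rewrite !Re_conjM !Im_conjM ReM ImM; congr EFin; ring.
Qed.

Lemma innerL2C u v : innerL2 v u = ((innerL2 u v)^*)%R.
Proof.
apply/eqP; rewrite eq_complex /=; apply/andP; split; apply/eqP.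
  by congr fine; apply: eq_integral => x _; rewrite !Re_conjM; congr EFin; ring.
rewrite -mulN1r -RintegralZl//; last exact: integrable_Im_conjM.
by congr fine; apply: eq_integral => x _; rewrite /= !Im_conjM; congr EFin; ring.
Qed.

Lemma innerL2_ge0 u : 0 <= Re (innerL2 u u).
Proof.
by apply: Rintegral_ge0 => x _; rewrite Re_conjM addr_ge0// -expr2 sqr_ge0.
Qed.

Lemma innerL2_sumr I (r : seq I) (P : pred I) (f : I -> H) u :
  innerL2 u (\sum_(i <- r | P i) f i) = \sum_(i <- r | P i) innerL2 u (f i).
Proof.
apply: (big_morph _ (innerL2Dr u)).
by rewrite -(scale0r (0 : H)) innerL2Zr mul0r.
Qed.

Lemma innerL2Dl u v w : innerL2 (u + v) w = innerL2 u w + innerL2 v w.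
Proof.
by rewrite innerL2C innerL2Dr (innerL2C w u) (innerL2C w v); exact: rmorphD.
Qed.

Lemma innerL2Zl a u v : innerL2 (a *: u) v = a^* * innerL2 u v.
Proof. by rewrite innerL2C innerL2Zr (innerL2C v u); exact: rmorphM. Qed.

Lemma innerL2Nr u v : innerL2 u (- v) = - innerL2 u v.
Proof. by rewrite -scaleN1r innerL2Zr mulN1r. Qed.

Lemma innerL2Br u v w : innerL2 u (v - w) = innerL2 u v - innerL2 u w.
Proof. by rewrite innerL2Dr innerL2Nr. Qed.

Lemma innerL2Nl u v : innerL2 (- u) v = - innerL2 u v.
Proof. by rewrite innerL2C innerL2Nr (innerL2C v u); exact: rmorphN. Qed.

Lemma innerL2Bl u v w : innerL2 (u - v) w = innerL2 u w - innerL2 v w.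
Proof. by rewrite innerL2Dl innerL2Nl. Qed.

(** The norm of L2 takes its values in the complex scalars; this is the same
    number as a real. *)
Definition nrm u : R := Num.sqrt (Re (innerL2 u u)).

Lemma normE u : `|u| = (nrm u)%:C. Proof. exact: normL2_inner. Qed.

Lemma nrm_sqr u : nrm u ^+ 2 = Re (innerL2 u u).
Proof. by rewrite sqr_sqrtr ?innerL2_ge0. Qed.

Lemma nrm_ge0 u : 0 <= nrm u. Proof. exact: sqrtr_ge0. Qed.

Lemma nrm0_eq0 u : Re (innerL2 u u) = 0 -> u = 0.
Proof. by move=> u0; apply/eqP; rewrite -normr_eq0 normE /nrm u0 sqrtr0. Qed.

(** The triangle inequality of the norm, squared, is the Cauchy-Schwarz
    inequality for the real part. *)
Lemma Re_inner_le u v : Re (innerL2 u v) <= nrm u * nrm v.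
Proof.
have : nrm (u + v) <= nrm u + nrm v.
  by have := ler_normD u v; rewrite !normE -rmorphD lecR.
rewrite -(@ler_pXn2r _ 2)// ?nnegrE ?addr_ge0 ?nrm_ge0//.
rewrite sqrrD !nrm_sqr innerL2Dl !innerL2Dr !ReD (innerL2C u v).
have -> : Re ((innerL2 u v)^*)%R = Re (innerL2 u v) by case: innerL2.
by rewrite mulr2n; lra.
Qed.

Lemma Re_inner_norm_le u v : `|Re (innerL2 u v)| <= nrm u * nrm v.
Proof.
rewrite ler_norml Re_inner_le andbT lerNl.
have -> : nrm u * nrm v = nrm u * nrm (- v).
  by rewrite /nrm innerL2Nr innerL2Nl opprK.
have := Re_inner_le u (- v).
by rewrite innerL2Nr; case: innerL2.
Qed.

Lemma Re_inner_continuous v : continuous (fun w : H => Re (innerL2 v w)).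
Proof.
move=> w0; have nbhsF : Filter (nbhs w0) by exact: nbhs_filter.
apply/cvgrPdist_lt => e e0 /=.
have d0 : 0 < (e / (nrm v + 1))%:C :> R[i].
  by rewrite ltcR divr_gt0// ltr_wpDl// nrm_ge0.
have : \forall w \near w0, `|w0 - w| < (e / (nrm v + 1))%:C.
  by apply: (@cvgr_dist_lt _ _ _ (nbhs w0) _ id w0) => //; exact: cvg_id.
apply: filterS => w; rewrite normE ltcR => le.
have -> : Re (innerL2 v w0) - Re (innerL2 v w) = Re (innerL2 v (w0 - w)).
  by rewrite innerL2Br; case: innerL2 => ? ?; case: innerL2.
apply: le_lt_trans (Re_inner_norm_le _ _) _.
rewrite ltr_pdivlMr in le; last by rewrite ltr_wpDl// nrm_ge0.
apply: le_lt_trans le.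
by rewrite mulrC ler_wpM2l ?nrm_ge0// lerDl.
Qed.

(** The difference quotients of a real-variable curve in H converge in norm, so
    their inner products with a fixed vector converge as well. *)
Lemma derivative_at_Re x t (y v : H) : derivative_at x t y ->
  is_derive t 1 (fun s => Re (innerL2 v (x s))) (Re (innerL2 v y)).
Proof.
move=> dx.
have L : (h^-1 *: (((fun s => Re (innerL2 v (x s))) \o shift t) (h *: 1)
   - Re (innerL2 v (x t)))) @[h --> (0:R)^'] --> Re (innerL2 v y).
  rewrite (_ : (fun h => _) =
    (fun w => Re (innerL2 v w)) \o (fun h => h^-1%:C *: (x (t + h) - x t))).
    exact: cvg_comp dx (@Re_inner_continuous v y).
  apply/funext => h.
  rewrite -[RHS]/(Re (innerL2 v (h^-1%:C *: (x (t + h) - x t)))).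
  rewrite innerL2Zr innerL2Br ReM mul0r subr0.
  rewrite -[LHS]/(h^-1 * (Re (innerL2 v (x (h * 1 + t))) - Re (innerL2 v (x t)))).
  rewrite mulr1 (addrC h).
  by case: innerL2 => ? ?; case: innerL2.
by split; [apply/cvg_ex; eexists; exact: L | exact: cvg_lim L].
Qed.

Lemma Im_innerE u v : Im (innerL2 u v) = Re (innerL2 ('i *: u) v).
Proof. by rewrite innerL2Zl; case: innerL2 => ? ?; rewrite /= !mul0r; ring. Qed.

Lemma derivative_at_Im x t (y v : H) : derivative_at x t y ->
  is_derive t 1 (fun s => Im (innerL2 v (x s))) (Im (innerL2 v y)).
Proof.
move=> dx; rewrite Im_innerE.
have := derivative_at_Re ('i *: v) dx.
by under eq_fun do rewrite -Im_innerE.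
Qed.

End InnerProduct.

(** * Orthonormality of the Hermite functions *)

Section HermiteOrthonormal.
Variable R : realType.
Implicit Types (p q : {poly R}) (x : R) (n m : nat).

(** Multiplying by ['X] costs at most a multiple of [expR (e / 2 * x ^+ 2)],
    which leaves [e / 2] for the induction hypothesis. *)
Lemma poly_growth p (e : R) : 0 < e ->
  exists2 c : R, 0 <= c & forall x, `|p.[x]| <= c * expR (e * x ^+ 2).
Proof.
elim/poly_ind: p e => [|p a IH] e e0.
  by exists 0 => // x; rewrite horner0 normr0 mul0r.
have e20 : 0 < e / 2 by rewrite divr_gt0.
have [c c0 pc] := IH _ e20.
have d0 : 0 <= (e / 2)^-1 by rewrite invr_ge0 ltW.
exists (c * (1 + (e / 2)^-1) + `|a|).
  by rewrite addr_ge0// mulr_ge0// addr_ge0.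
move=> x; rewrite hornerMXaddC; set E := expR (e / 2 * x ^+ 2).
have E1 : 1 <= E by rewrite -expR0 ler_expR mulr_ge0 ?sqr_ge0 ?(ltW e20).
have xE : x ^+ 2 <= (e / 2)^-1 * E.
  rewrite mulrC ler_pdivlMr// mulrC.
  by rewrite (le_trans _ (expR_ge1Dx _))// lerDr.
have absx : `|x| <= 1 + x ^+ 2.
  have := sqr_ge0 (`|x| - 1); rewrite sqrrB expr1n mulr1 real_normK ?num_real//.
  by have := normr_ge0 x; rewrite mulr2n; lra.
have -> : expR (e * x ^+ 2) = E * E by rewrite -expRD; congr expR; lra.
apply: le_trans (ler_normD _ _) _; rewrite normrM mulrDl lerD//.
  rewrite mulrAC mulrA mulrAC -mulrA ler_pM// (le_trans absx)//.
  by rewrite mulrDl mul1r lerD.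
by rewrite ler_peMr// -[leLHS]mulr1 ler_pM.
Qed.

Lemma poly_gauss_le p :
  exists2 c : R, 0 <= c &
    forall x, `|p.[x] * gauss_fun x| <= c * expR (- (x ^+ 2 / 2)).
Proof.
have [c c0 pc] := poly_growth p (e := 2^-1) ltac:(by rewrite invr_gt0).
exists c => // x; rewrite normrM (ger0_norm (expR_ge0 _)).
apply: le_trans (ler_wpM2r (expR_ge0 _) (pc x)) _.
by rewrite -mulrA -expRD ler_wpM2l// ler_expR; lra.
Qed.

Lemma measurable_poly_gauss p :
  measurable_fun [set: R] (fun x => p.[x] * gauss_fun x).
Proof.
apply: measurable_funM; first exact: measurable_poly.
exact: measurable_gauss_fun.
Qed.

Lemma integrable_poly_gauss p :
  (lebR R).-integrable setT (EFin \o (fun x => p.[x] * gauss_fun x)).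
Proof.
have [c c0 pc] := poly_gauss_le p.
apply: (@le_integrable _ _ _ _ _ measurableT _
  (fun x : measurableTypeR R =>
     ((c / normal_peak 1)%:E * (normal_pdf 0 1 x)%:E)%E)).
- by apply/measurable_EFinP; exact: measurable_poly_gauss.
- move=> x _ /=; rewrite lee_fin (le_trans (pc x))//.
  have p1 : 0 < normal_peak (1 : R) by rewrite normal_peak_gt0// oner_eq0.
  rewrite normal_pdfE ?oner_eq0// mulrA divfK ?gt_eqF// /normal_fun subr0.
  rewrite expr1n ger0_norm ?mulr_ge0 ?expR_ge0//.
  by rewrite mulNr.
- by apply: integrableZl => //; exact: integrable_normal_pdf.
Qed.

Definition gauss_moment p : R := (\int[lebR R]_x (p.[x] * gauss_fun x))%R.

Lemma gauss_momentD p q : gauss_moment (p + q) = gauss_moment p + gauss_moment q.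
Proof.
rewrite /gauss_moment -RintegralD//; [|exact: integrable_poly_gauss..].
by apply: eq_Rintegral => x _; rewrite hornerD mulrDl.
Qed.

Lemma gauss_momentZ (a : R) p : gauss_moment (a *: p) = a * gauss_moment p.
Proof.
rewrite /gauss_moment -RintegralZl//; last exact: integrable_poly_gauss.
by apply: eq_Rintegral => x _; rewrite hornerZ mulrA.
Qed.

Lemma gauss_moment1 : gauss_moment 1 = Num.sqrt pi.
Proof.
rewrite /gauss_moment /Rintegral -[RHS]/(fine (Num.sqrt pi)%:E) -integralT_gauss.
by congr fine; apply: eq_integral => x _; rewrite hornerC mul1r.
Qed.

Lemma is_derive_poly_gauss p x : is_derive x 1 (fun y => p.[y] * gauss_fun y)
  ((p^`() - 2%:P * 'X * p).[x] * gauss_fun x).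
Proof.
have dg : is_derive x 1 gauss_fun (- (2 * x) * gauss_fun x).
  rewrite /gauss_fun; apply: is_derive_eq.
  by rewrite /GRing.scale /= mulr1; ring.
have dp : is_derive x 1 (horner p) (p^`()).[x] := is_derive_poly p x.
apply: (is_derive_eq (is_deriveM dp dg)).
by rewrite !(hornerD, hornerN, hornerM, hornerX, hornerC) /GRing.scale /=; ring.
Qed.


Lemma continuous_poly_gauss p : continuous (fun x => p.[x] * gauss_fun x).
Proof.
move=> x; apply/differentiable_continuous/derivable1_diffP.
by have [] := is_derive_poly_gauss p x.
Qed.

(** The integral of the derivative of a function vanishing at both ends of the
    line; the symmetric segments are passed to the limit under the integral. *)
Lemma gauss_moment_deriv p : gauss_moment (p^`() - 2%:P * 'X * p) = 0.
Proof.
set q := p^`() - _; pose g x := q.[x] * gauss_fun x.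
pose F x := p.[x] * gauss_fun x.
have dF x : is_derive x 1 F (g x) by exact: is_derive_poly_gauss.
have cF : continuous F by move=> x; exact: continuous_poly_gauss.
have ig : (lebR R).-integrable setT (EFin \o g) := integrable_poly_gauss q.
pose I n : set (measurableTypeR R) := `[- n.+1%:R, n.+1%:R]%classic.
have mI n : measurable (I n) by exact: measurable_itv.
have /integrableP[mg _] := ig.
have dom : (\int[lebR R]_x ((EFin \o g) \_ (I n)) x)%E @[n --> \oo] -->
    (\int[lebR R]_x (EFin \o g) x)%E.
  have [] := @dominated_convergence _ _ _ (lebR R) setT measurableT
    (fun n => (EFin \o g) \_ (I n)) (EFin \o g) (abse \o (EFin \o g)).
  - move=> n; apply/(measurable_restrictT _ _).1 => //.
    exact: (measurable_funS measurableT (@subsetT _ _) mg).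
  - exact: mg.
  - apply: aeW => x _; apply: cvg_near_cst; near=> n.
    rewrite patchE mem_set// /I /= in_itv /= -ler_norml.
    apply: (@le_trans _ _ n%:R); last by rewrite ler_nat.
    by near: n; exact: nbhs_infty_ger.
  - exact: integrable_abse.
  - apply: aeW => x n _; rewrite patchE; case: ifP => // _.
    by rewrite abse0; exact: abse_ge0.
  - by [].
have Fbd n : (\int[lebR R]_x ((EFin \o g) \_ (I n)) x)%E =
    (F (1 * n.+1%:R) - F (-1 * n.+1%:R))%:E.
  rewrite -integral_mkcond EFinB mul1r mulN1r.
  apply: (@continuous_FTC2 _ g F).
  - by rewrite ltrNl (lt_trans _ (ltr0Sn _ _))// oppr_lt0.
  - by apply: continuous_subspaceT => x; exact: continuous_poly_gauss.
  - split; first by move=> x _; exact: ex_derive.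
    + by apply: cvg_at_right_filter; exact: cF.
    + by apply: cvg_at_left_filter; exact: cF.
  - by move=> x _; rewrite derive1E; exact: derive_val.
have [c c0 Fc] := poly_gauss_le p.
have F0 (s : R) : s ^+ 2 = 1 -> F (s * n.+1%:R) @[n --> \oo] --> (0 : R).
  move=> s1; apply: norm_cvg0.
  apply: (@squeeze_cvgr _ _ _ _ (cst 0) (c \*o harmonic)).
  - near=> n; rewrite normr_ge0 (le_trans (Fc _))//= ler_wpM2l//.
    rewrite /harmonic expRN lef_pV2 ?posrE ?expR_gt0// exprMn s1 mul1r.
    apply: le_trans (expR_ge1Dx _).
    by have := sqr_ge0 (n.+1%:R - 1 : R); rewrite sqrrB mulr2n expr1n; lra.
  - exact: cvg_cst.
  - by rewrite -[0](mulr0 c); apply: cvgMr; exact: cvg_harmonic.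
rewrite /gauss_moment /Rintegral -[RHS]/(fine 0%:E); congr fine.
have lim0 : (F (1 * n.+1%:R) - F (-1 * n.+1%:R))%:E @[n --> \oo] --> (0 : \bar R).
  apply: cvg_EFin; first by near=> n.
  rewrite -[X in _ --> X](subr0 0); apply: cvgB; apply: F0.
  - by rewrite expr1n.
  - by rewrite sqrrN expr1n.
have {}Fbd := funext Fbd; rewrite Fbd in dom.
exact: cvg_unique dom lim0.
Unshelve. all: by end_near.
Qed.

Lemma hermiteS m :
  hermite R m.+1 = 2%:P * 'X * hermite R m - (hermite R m)^`().
Proof. by []. Qed.

(** For the Gaussian weight, the adjoint of the derivation is the operator
    [f |-> 2 X f - f'] that builds the Hermite polynomials. *)
Lemma gauss_momentM_hermiteS q m :
  gauss_moment (q * hermite R m.+1) = gauss_moment (q^`() * hermite R m).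
Proof.
have := gauss_moment_deriv (q * hermite R m).
rewrite -scaleN1r gauss_momentD gauss_momentZ mulN1r.
move/eqP; rewrite subr_eq0 derivM gauss_momentD => /eqP E.
rewrite hermiteS mulrBr -scaleN1r gauss_momentD gauss_momentZ mulN1r.
rewrite (_ : q * (2%:P * 'X * hermite R m) = 2%:P * 'X * (q * hermite R m)).
  by rewrite -E addrK.
by rewrite mulrCA.
Qed.

Lemma deriv_hermiteS m : (hermite R m.+1)^`() = (2 * m.+1%:R) *: hermite R m.
Proof.
elim: m => [|m IH].
  rewrite hermiteS [hermite R 0]/= derivC subr0 mulr1 derivM derivC derivX.
  by rewrite mul0r add0r -mul_polyC !mulr1.
rewrite [in LHS]hermiteS IH derivB derivZ derivM IH derivM derivC derivX.
rewrite mul0r add0r mulr1 (hermiteS m) -!mul_polyC.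
rewrite -[m.+2%:R]natr1 !polyCM !polyCD polyC1; ring.
Qed.

Lemma gauss_moment_hermite n m : gauss_moment (hermite R n * hermite R m) =
  (n == m)%:R * (2 ^+ n * n`!%:R * Num.sqrt pi).
Proof.
elim: n m => [|n IH] [|m].
- by rewrite mulr1 gauss_moment1 eqxx expr0 fact0 !mul1r.
- by rewrite gauss_momentM_hermiteS derivC mul0r -(scale0r 1) gauss_momentZ !mul0r.
- rewrite mulrC gauss_momentM_hermiteS derivC mul0r -(scale0r 1) gauss_momentZ.
  by rewrite !mul0r.
- rewrite gauss_momentM_hermiteS deriv_hermiteS -scalerAl gauss_momentZ IH eqSS.
  by rewrite exprS factS natrM; ring.
Qed.


Lemma innerL2_phi n m : (0 < n)%N -> (0 < m)%N ->
  innerL2 (phi R n) (phi R m) = (n == m)%:R.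
Proof.
case: n => // n _; case: m => // m _; rewrite eqSS /phi innerL2E /=.
pose c n : R := (Num.sqrt (2 ^+ n * n`!%:R * Num.sqrt pi))^-1.
have E : (\int[lebR R]_x (hermite_fun n x * hermite_fun m x))%R = (n == m)%:R.
  rewrite (_ : (\int[lebR R]_x _)%R =
      c n * c m * gauss_moment (hermite R n * hermite R m)).
    rewrite gauss_moment_hermite.
    case: eqVneq => [<-|_]; last by rewrite mul0r mulr0.
    have c0 : 0 < 2 ^+ n * n`!%:R * Num.sqrt (pi : R).
      by rewrite !mulr_gt0 ?exprn_gt0 ?ltr0n ?fact_gt0 ?sqrtr_gt0 ?pi_gt0.
    by rewrite mul1r -expr2 exprVn sqr_sqrtr ?ltW// mulVf ?gt_eqF.
  rewrite /gauss_moment -RintegralZl//; last exact: integrable_poly_gauss.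
  apply: eq_Rintegral => x _; rewrite hornerM /hermite_fun -/(c n) -/(c m).
  rewrite (_ : gauss_fun x = expR (- x ^+ 2 / 2) * expR (- x ^+ 2 / 2)).
    by ring.
  by rewrite -expRD; congr expR; lra.
apply/eqP; rewrite eq_complex; apply/andP; split; apply/eqP.
- rewrite /= (_ : complex.Re _ = (n == m)%:R); last by case: eqP.
  rewrite -E; apply: eq_Rintegral => x _ /=.
  by rewrite mulr0 subr0.
- rewrite /= (_ : complex.Im (n == m)%:R = 0); last by case: eqP.
  rewrite /Rintegral -[RHS]/(fine 0%E); congr fine.
  apply: integral0_eq => x _ /=.
  by congr EFin; ring.
Qed.

End HermiteOrthonormal.

(** * Comparison of square roots *)

Section SqrtComparison.
Variable R : realType.
Implicit Types (f g h : R -> R) (s r t : R).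

(** Divided by [2 * sqrt f], the hypothesis on the derivatives says that
    [sqrt f] grows no faster than [h].  As [sqrt] is not differentiable at [0],
    the argument runs with [sqrt (f + e ^+ 2)] for every [e > 0]. *)
Lemma sqrt_le_of_derive f h s r :
  {within `[s, r], continuous f} -> continuous h ->
  (forall t, s <= t <= r -> 0 <= f t) ->
  (forall t, s < t < r -> exists d e, [/\ is_derive t 1 f d,
     is_derive t 1 h e, 0 <= e & d <= 2 * Num.sqrt (f t) * e]) ->
  Num.sqrt (f s) <= h s ->
  forall t, s <= t <= r -> Num.sqrt (f t) <= h t.
Proof.
move=> cf ch f0 fh fhs t /andP[st tr]; apply/ler_addgt0Pr => e e0.
pose g t := Num.sqrt (f t + e ^+ 2) - h t.
have e20 : 0 < e ^+ 2 by rewrite exprn_gt0.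
have fe0 u : s <= u <= r -> 0 < f u + e ^+ 2 by move=> /f0 ?; rewrite ltr_wpDl.
have dg u : s < u < r -> exists2 d, is_derive u 1 g d & d <= 0.
  move=> /[dup] sur /fh [d] [d'] [fd hd d'0 dd'].
  have {sur} su : s <= u <= r by case/andP: sur => *; rewrite !ltW.
  have fu0 := fe0 _ su.
  have sq0 : 0 < Num.sqrt (f u + e ^+ 2) by rewrite sqrtr_gt0.
  have sd : is_derive u 1 (Num.sqrt \o (fun v => f v + e ^+ 2))
      ((2 * Num.sqrt (f u + e ^+ 2))^-1 * d).
    have fd' : is_derive u 1 (fun v => f v + e ^+ 2) d.
      by apply: (is_derive_eq (is_deriveD fd (is_derive_cst (e ^+ 2) u 1)));
        rewrite addr0.
    have := @is_derive1_comp _ Num.sqrt _ u _ d (is_derive1_sqrt fu0) fd'. exact.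
  exists ((2 * Num.sqrt (f u + e ^+ 2))^-1 * d - d').
    exact: is_deriveB.
  rewrite subr_le0 mulrC ler_pdivrMr ?mulr_gt0// (le_trans dd')//.
  rewrite [leRHS]mulrC ler_wpM2r// ler_wpM2l// ler_sqrt ?lerDl ?ltW//.
have gle : g t <= g s.
  have cg : {within `[s, r], continuous g}.
    move=> x; apply: cvgB; last exact: (continuous_subspaceT ch).
    apply: (@continuous_comp _ _ _ (fun v : subspace `[s, r] => f v + e ^+ 2)).
      by apply: cvgD; [exact: cf|exact: cvg_cst].
    exact: sqrt_continuous.
  apply: (@ler0_derive1_le_cc _ _ s r) => //.
  - by move=> x; rewrite in_itv /= => /dg[d gd _]; exact: ex_derive.
  - by move=> x; rewrite in_itv /= => /dg[d gd d0]; rewrite derive1E derive_val.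
  - by rewrite in_itv /= st.
  - by rewrite in_itv /= lexx (le_trans st).
have fs0 : 0 <= f s by rewrite f0// lexx (le_trans st).
have ft0 : 0 <= f t by rewrite f0// st.
have h1 : Num.sqrt (f t) <= Num.sqrt (f t + e ^+ 2).
  by rewrite ler_sqrt ?lerDl ?ltW// ltr_wpDl.
have h2 : Num.sqrt (f s + e ^+ 2) <= Num.sqrt (f s) + e.
  rewrite -(@ler_pXn2r _ 2)// ?nnegrE ?addr_ge0 ?sqrtr_ge0 ?(ltW e0)//.
  rewrite sqrrD !sqr_sqrtr ?(ltW e20) ?addr_ge0 ?(ltW e20)//.
  by rewrite lerD2r lerDl mulrn_wge0// mulr_ge0 ?sqrtr_ge0// ltW.
by move: gle; rewrite /g; lra.
Qed.

(** The same with [h t = c * (v + b * (t - s)) ^+ m.+1]. *)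
Lemma sqrt_le_powS_of_derive f s r (c v b : R) m :
  0 <= c -> 0 <= v -> 0 <= b -> {within `[s, r], continuous f} ->
  (forall t, s <= t <= r -> 0 <= f t) ->
  (forall t, s < t < r -> exists2 d, is_derive t 1 f d &
     d <= 2 * Num.sqrt (f t) * (b * (m.+1%:R * c * (v + b * (t - s)) ^+ m))) ->
  Num.sqrt (f s) <= c * v ^+ m.+1 ->
  forall t, s <= t <= r -> Num.sqrt (f t) <= c * (v + b * (t - s)) ^+ m.+1.
Proof.
move=> c0 v0 b0 cf f0 df fs.
pose h t := c * (v + b * (t - s)) ^+ m.+1.
have dh t : is_derive t 1 h (b * (m.+1%:R * c * (v + b * (t - s)) ^+ m)).
  have dl : is_derive t 1 (fun u : R => v + b * (u - s)) b.
    by apply: is_derive_eq; rewrite /GRing.scale /=; ring.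
  have := is_deriveZ c (is_deriveX m.+1 dl); rewrite exprfctE => hd.
  apply: (is_derive_eq hd).
  by rewrite /GRing.scale /=; ring.
apply: (@sqrt_le_of_derive f h) => //.
- move=> t; apply/differentiable_continuous/derivable1_diffP.
  by have [] := dh t.
- move=> t str; have [d fd dle] := df t str.
  exists d, (b * (m.+1%:R * c * (v + b * (t - s)) ^+ m)); split => //.
  have st : 0 <= t - s by case/andP: str => /ltW; rewrite subr_ge0.
  by rewrite !mulr_ge0// exprn_ge0// addr_ge0// mulr_ge0.
- by rewrite /h subrr mulr0 addr0.
Qed.

End SqrtComparison.

(** * Coefficients, tails and the Hamiltonian *)

Section Galerkin.
Variable R : realType.
Local Notation H := (L2 R).
Local Notation Re := (@complex.Re R).
Local Notation Im := (@complex.Im R).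
Implicit Types (eta b t : R) (k l n N : nat) (v w : H) (z : R -> H).

Definition coef k v : R[i] := innerL2 (phi R k) v.

Definition mass k v : R := Re (coef k v) ^+ 2 + Im (coef k v) ^+ 2.

Lemma mass_ge0 k v : 0 <= mass k v.
Proof. by rewrite addr_ge0 ?sqr_ge0. Qed.

Lemma massE k v : (mass k v)%:C = (coef k v)^* * coef k v.
Proof.
by rewrite /mass; case: coef => a b /=; rewrite !expr2; congr (_ +i* _); ring.
Qed.

Lemma coef_projN N k v : (0 < k)%N ->
  coef k (projN N v) = if (k <= N)%N then coef k v else 0.
Proof.
move=> k0; rewrite /coef /projN innerL2_sumr.
under eq_big_nat => l /andP[l0 _] do rewrite innerL2Zr innerL2_phi//.
case: leqP => kN.
  rewrite (bigD1_seq k) ?mem_index_iota ?k0 ?iota_uniq//=.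
  rewrite eqxx mulr1 big1 ?addr0// => l lk.
  by rewrite eq_sym (negbTE lk) mulr0.
rewrite big_nat big1// => l /andP[_ lN]; rewrite eqn_leq.
by rewrite (leqNgt k) (leq_trans lN)//= mulr0.
Qed.

Lemma projN_linear N (a : R[i]) v w :
  projN N (a *: v + w) = a *: projN N v + projN N w.
Proof.
rewrite /projN scaler_sumr -big_split /=; apply: eq_bigr => k _.
by rewrite innerL2Dr innerL2Zr scalerDl scalerA.
Qed.

Lemma projNB N v w : projN N (v - w) = projN N v - projN N w.
Proof. by rewrite addrC -scaleN1r projN_linear scaleN1r addrC. Qed.

Lemma projN_id N v : projN N (projN N v) = projN N v.
Proof.
rewrite {1}/projN; apply: eq_big_nat => k /andP[k0 kN].
by rewrite -/(coef k (projN N v)) coef_projN// -ltnS kN.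
Qed.

Lemma projN_phi N j : (0 < j <= N)%N -> projN N (phi R j) = phi R j.
Proof.
case/andP=> j0 jN; rewrite /projN (bigD1_seq j) ?mem_index_iota ?j0 ?iota_uniq//=.
rewrite innerL2_phi// eqxx scale1r big_seq_cond big1 ?addr0// => k.
rewrite mem_index_iota => /andP[/andP[k0 _] kj].
by rewrite innerL2_phi// (negbTE kj) scale0r.
Qed.

Lemma inner_projN N v w : innerL2 w (projN N v) =
  \sum_(1 <= k < N.+1) (coef k w)^* * coef k v.
Proof.
rewrite innerL2_sumr; apply: eq_bigr => k _.
by rewrite innerL2Zr (innerL2C (phi R k) w) mulrC.
Qed.

Lemma inner_projN_self N v :
  Re (innerL2 v (projN N v)) = \sum_(1 <= k < N.+1) mass k v.
Proof.
rewrite inner_projN (_ : \sum_(1 <= k < N.+1) _ =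
  (\sum_(1 <= k < N.+1) mass k v)%:C) // rmorph_sum /=.
by apply: eq_bigr => k _; rewrite massE.
Qed.

Lemma nrm_projN N v : nrm (projN N v) = Num.sqrt (\sum_(1 <= k < N.+1) mass k v).
Proof.
rewrite /nrm -[X in innerL2 _ X]projN_id inner_projN_self; congr Num.sqrt.
apply: eq_big_nat => k /andP[k0 kN].
by rewrite /mass coef_projN// -ltnS kN.
Qed.

Lemma innerBprojN N v w : innerL2 (v - projN N v) (projN N w) = 0.
Proof.
rewrite inner_projN big_nat big1// => k /andP[k0 kN].
rewrite /coef innerL2Br -!/(coef _ _) coef_projN// -ltnS kN subrr.
by rewrite rmorph0 mul0r.
Qed.

(** By Pythagoras, the squared distance from [v] to the span of the first [N]
    Hermite functions. *)
Definition tail N v : R := Re (innerL2 v v) - \sum_(1 <= k < N.+1) mass k v.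

Lemma tail_ge0 N v : 0 <= tail N v.
Proof.
rewrite (_ : tail N v = Re (innerL2 (v - projN N v) (v - projN N v))).
  exact: innerL2_ge0.
rewrite innerL2Br innerBprojN subr0 innerL2Bl (innerL2C v (projN N v)).
by rewrite /tail -inner_projN_self; case: innerL2 => ? ?; case: innerL2.
Qed.

Lemma tailS N v : tail N.+1 v = tail N v - mass N.+1 v.
Proof. by rewrite /tail big_nat_recr//= opprD addrA. Qed.

Lemma tail_phi N j : (0 < j <= N)%N -> tail N (phi R j) = 0.
Proof.
by move=> jN; rewrite /tail -inner_projN_self projN_phi// subrr.
Qed.

Lemma mass_le_tail N v : mass N.+1 v <= tail N v.
Proof. by have := tail_ge0 N.+1 v; rewrite tailS subr_ge0. Qed.

(** For the control value [b], the Schroedinger equation gives the k-th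
    coefficient the derivative [- 'i * ham eta b k v]; so does its Galerkin
    approximation of order [N] when [k <= N] and [v] is in the range of
    [projN N].  At [k = 1] the junk coefficient [coef 0 v] comes with the factor
    [sqrt 0]. *)
Definition ham eta b k v : R[i] := (lambda_eta eta k)%:C * coef k v +
  b%:C * ((Num.sqrt k.-1%:R)%:C * coef k.-1 v + (Num.sqrt k%:R)%:C * coef k.+1 v).

Lemma inner_Bphi k v : innerL2 (Bphi R k) v =
  'i * ((Num.sqrt k.-1%:R)%:C * coef k.-1 v + (Num.sqrt k%:R)%:C * coef k.+1 v).
Proof.
rewrite /Bphi innerL2Dl !innerL2Zl -!/(coef _ v).
move: (coef k.-1 v) (coef k.+1 v) => [x y] [x' y'].
by apply/eqP; rewrite eq_complex /=; apply/andP; split; apply/eqP; ring.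
Qed.

Lemma Bphi_antisym k l : (0 < k)%N -> (0 < l)%N ->
  innerL2 (phi R k) (Bphi R l) = - innerL2 (Bphi R k) (phi R l).
Proof.
move=> k0 l0; rewrite inner_Bphi /Bphi innerL2Dr !innerL2Zr.
have E i j : (0 < i)%N -> (Num.sqrt j.-1%:R)%:C * innerL2 (phi R i) (phi R j.-1) =
    (Num.sqrt j.-1%:R)%:C * (i == j.-1)%:R :> R[i].
  case: j => [|[|j]] i0 /=; rewrite ?sqrtr0 ?mul0r//.
  by rewrite innerL2_phi.
rewrite (innerL2_phi R k0 (ltn0Sn l)) -!mulrA E// /coef.
rewrite (innerL2_phi R (ltn0Sn k) l0).
have -> : (Num.sqrt k.-1%:R)%:C * innerL2 (phi R k.-1) (phi R l) =
    (Num.sqrt k.-1%:R)%:C * (k.-1 == l)%:R :> R[i].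
  case: k k0 => [|[|k]] //= _; rewrite ?sqrtr0 ?mul0r//.
  by rewrite innerL2_phi.
rewrite -mulrDr mulNr; congr (- ('i * _)).
case: l l0 k k0 {E} => // l _ [|k] // _; rewrite /= !eqSS addrC.
rewrite [in RHS](eq_sym k) [in RHS](eq_sym _ l).
by congr (_ + _); case: eqVneq => [->|]; rewrite ?mulr0.
Qed.

(** Every pair in the graph of [opB] is a finite combination of the pairs of
    [opB_phi], so its second component can be moved onto the basis without
    knowing the coefficients of the combination. *)
Lemma opB_adj v w k : (0 < k)%N -> @opB R (v, w) ->
  coef k w = - innerL2 (Bphi R k) v.
Proof.
move=> k0 [n [c [-> ->]]]; rewrite /coef !innerL2_sumr -sumrN.
apply: eq_big_nat => l /andP[l0 _].
by rewrite !innerL2Zr Bphi_antisym// mulrN.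
Qed.

Lemma opA_phi eta k : (0 < k)%N ->
  opA eta (phi R k, (- 'i * (lambda_eta eta k)%:C) *: phi R k).
Proof.
move=> k0 l l0 /=; rewrite innerL2Zr innerL2_phi//.
by case: eqVneq => [->|]; rewrite ?mulr0.
Qed.

Lemma opB_phi k : (0 < k)%N -> @opB R (phi R k, Bphi R k).
Proof.
move=> k0; exists k, (fun l => (l == k)%:R).
rewrite !(bigD1_seq k) ?mem_index_iota ?k0 ?iota_uniq//= !eqxx !scale1r.
by rewrite !big1 ?addr0// => l /negbTE ->; rewrite scale0r.
Qed.

End Galerkin.

(** * Evolution of the coefficients *)

Section Dynamics.
Variable R : realType.
Local Notation H := (L2 R).
Local Notation Re := (@complex.Re R).
Local Notation Im := (@complex.Im R).
Implicit Types (eta b s t : R) (k l n N : nat) (v w : H) (z : R -> H).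

Definition coef_ode N eta b z t : Prop := forall k, (0 < k <= N)%N ->
  is_derive t 1 (fun s => Re (coef k (z s))) (Im (ham eta b k (z t))) /\
  is_derive t 1 (fun s => Im (coef k (z s))) (- Re (ham eta b k (z t))).

Lemma Re_realM (x : R) (c : R[i]) : Re (x%:C * c) = x * Re c.
Proof. by rewrite ReM /= mul0r subr0. Qed.

Lemma Im_realM (x : R) (c : R[i]) : Im (x%:C * c) = x * Im c.
Proof. by rewrite ImM /= mul0r addr0. Qed.

Lemma coefB k v w : coef k (v - w) = coef k v - coef k w.
Proof. exact: innerL2Br. Qed.

Lemma hamB eta b k v w : ham eta b k (v - w) = ham eta b k v - ham eta b k w.
Proof. by rewrite /ham !coefB; ring. Qed.

Lemma coef_odeB N eta b z1 z2 t :
  coef_ode N eta b z1 t -> coef_ode N eta b z2 t ->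
  coef_ode N eta b (fun s => z1 s - z2 s) t.
Proof.
move=> h1 h2 k kN; have [r1 i1] := h1 k kN; have [r2 i2] := h2 k kN; split.
- have -> : (fun s => Re (coef k (z1 s - z2 s))) =
      (fun s => Re (coef k (z1 s)) - Re (coef k (z2 s))).
    by apply/funext => s; rewrite coefB; case: coef => ? ?; case: coef.
  rewrite (_ : Im _ = Im (ham eta b k (z1 t)) - Im (ham eta b k (z2 t))).
    exact: is_deriveB.
  by rewrite hamB; case: ham => ? ?; case: ham.
- have -> : (fun s => Im (coef k (z1 s - z2 s))) =
      (fun s => Im (coef k (z1 s)) - Im (coef k (z2 s))).
    by apply/funext => s; rewrite coefB; case: coef => ? ?; case: coef.
  rewrite (_ : - Re _ = - Re (ham eta b k (z1 t)) - - Re (ham eta b k (z2 t))).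
    exact: is_deriveB.
  by rewrite hamB; case: ham => ? ?; case: ham => ? ? /=; rewrite opprB opprK addrC.
Qed.

(** The rate at which the first [N] coefficients receive mass from the others
    when the control has the value [b]. *)
Definition flux b N v : R := 2 * b * Num.sqrt N%:R *
  (Re (coef N v) * Im (coef N.+1 v) - Im (coef N v) * Re (coef N.+1 v)).

(** The Hamiltonian is tri-diagonal and hermitian, so the exchanges between
    neighbouring coefficients cancel except at the cut. *)
Lemma is_derive_mass_sum N eta b z t : coef_ode N eta b z t ->
  is_derive t 1 (fun s => \sum_(1 <= k < N.+1) mass k (z s)) (flux b N (z t)).
Proof.
elim: N => [|N IH] ode.
  rewrite (_ : (fun s => _) = cst 0); last first.
    by apply/funext => s; rewrite big_geq.
  by rewrite /flux sqrtr0 mulr0 mul0r; exact: is_derive_cst.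
have {}IH : is_derive t 1 (fun s => \sum_(1 <= k < N.+1) mass k (z s))
    (flux b N (z t)).
  by apply: IH => k /andP[k0 kN]; apply: ode; rewrite k0 leqW.
have [dp dq] := ode N.+1 (leqnn _).
rewrite (_ : (fun s => _) = (fun s => \sum_(1 <= k < N.+1) mass k (z s) +
   (Re (coef N.+1 (z s)) ^+ 2 + Im (coef N.+1 (z s)) ^+ 2))); last first.
  by apply/funext => s; rewrite big_nat_recr.
have := is_deriveD IH (is_deriveD (is_deriveX 2 dp) (is_deriveX 2 dq)).
move=> dm; apply: (is_derive_eq dm).
rewrite /flux /ham ReD ImD !Re_realM !Im_realM ReD ImD !Re_realM !Im_realM /=.
rewrite /GRing.scale /= !expr1; ring.
Qed.

Lemma flux_le b N v : `|flux b N v| <=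
  2 * (`|b| * Num.sqrt N%:R) * (Num.sqrt (mass N v) * Num.sqrt (mass N.+1 v)).
Proof.
rewrite /flux normrM.
rewrite (_ : `|2 * b * Num.sqrt N%:R| = 2 * (`|b| * Num.sqrt N%:R)); last first.
  by rewrite !normrM (ger0_norm (sqrtr_ge0 _)) ger0_norm// mulrA.
rewrite ler_wpM2l ?mulr_ge0 ?sqrtr_ge0//.
rewrite -sqrtrM ?mass_ge0// -sqrtr_sqr ler_sqrt ?mulr_ge0 ?mass_ge0//.
rewrite /mass; move: (Re (coef N v)) (Im (coef N v)) => x y.
move: (Re _) (Im _) => x' y'; have := sqr_ge0 (x * x' + y * y'); nra.
Qed.

(** Since [U] is isometric, [<phi_k, U_(r - s) w>] equals
    [<U_(t - r) phi_k, U_(t - s) w>].  The curve [r |-> U_(t - r) phi_k] is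
    differentiable at [t] because [phi_k] is in the domain of the generator;
    nothing is asked from [w]. *)
Lemma unitary_coef_ode N eta b U w s t : unitary_group U ->
  generator U = closure (perturb (opA eta) (@opB R) b) ->
  coef_ode N eta b (fun t => U (t - s) w) t.
Proof.
move=> [_ isoU U0 UD _] gU k /andP[k0 _].
pose y := - 'i * (lambda_eta eta k)%:C *: phi R k + b%:C *: Bphi R k.
have dU : derivative_at (U^~ (phi R k)) 0 y.
  have : generator U (phi R k, y).
    rewrite gU; apply: subset_closure.
    exists (- 'i * (lambda_eta eta k)%:C *: phi R k), (Bphi R k).
    by split; [exact: opA_phi|exact: opB_phi|].
  by [].
set v := U (t - s) w.
have adj r : innerL2 (phi R k) (U (r - s) w) =
    ((innerL2 v (U (t - r) (phi R k)))^*)%R.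
  rewrite -innerL2C -[LHS](isoU (t - r)) -UD addrA subrK.
  by [].
have yE : innerL2 v y = (('i * ham eta b k v)^*)%R.
  rewrite innerL2C; congr (_^*)%R.
  rewrite innerL2Dl !innerL2Zl inner_Bphi /ham -/(coef k v).
  move: (coef k v) (coef k.-1 v) (coef k.+1 v) => [x x'] [x1 x1'] [x2 x2'].
  by apply/eqP; rewrite eq_complex /=; apply/andP; split; apply/eqP; ring.
have dl : is_derive t 1 (fun r : R => t - r) (-1).
  by apply: is_derive_eq; rewrite /GRing.scale /=; ring.
have dUt : derivative_at (U^~ (phi R k)) (t - t) y by rewrite subrr.
have := @is_derive1_comp _ _ _ t _ _ (derivative_at_Im v dUt) dl.
have := @is_derive1_comp _ _ _ t _ _ (derivative_at_Re v dUt) dl.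
rewrite yE => dr di; split.
- rewrite (_ : (fun r => _) = (fun r => Re (innerL2 v (U r (phi R k)))) \o
    (fun r => t - r)); last first.
    apply/funext => r; rewrite /coef adj /comp.
    by move: (innerL2 v _) => [? ?].
  apply: (is_derive_eq dr).
  by case: ham => x x' /=; ring.
- rewrite (_ : (fun r => _) = - ((fun r => Im (innerL2 v (U r (phi R k)))) \o
    (fun r => t - r))); last first.
    apply/funext => r; rewrite /coef adj opprfctE /comp.
    by move: (innerL2 v _) => [? ?].
  apply: (is_derive_eq (is_deriveN di)).
  by case: ham => x x' /=; ring.
Qed.

Lemma coef_generator_galerkin eta N b v y : projN N v = v ->
  perturb (compress N (opA eta)) (compress N (@opB R)) b (v, y) ->
  forall k, (0 < k <= N)%N -> coef k y = - 'i * ham eta b k v.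
Proof.
move=> vN [y1 [y2 /= [[w1 A1 E1] [w2 B2 E2]]]] -> k /andP[k0 kN].
move: A1 B2 E1 E2 => /=; rewrite vN => A1 B2 -> ->.
rewrite /coef innerL2Dr innerL2Zr -!/(coef k _) !coef_projN// kN.
rewrite [coef k w1](A1 k k0) (opB_adj k0 B2) inner_Bphi /ham -/(coef k v).
by ring.
Qed.

Lemma galerkin_range eta N b v y :
  perturb (compress N (opA eta)) (compress N (@opB R)) b (v, y) ->
  projN N y = y.
Proof.
move=> [y1 [y2 /= [[w1 _ E1] [w2 _ E2]]]] ->.
by rewrite /= in E1 E2; rewrite E1 E2 addrC projN_linear !projN_id.
Qed.

Lemma galerkin_coef_ode N eta b z t y : projN N (z t) = z t ->
  perturb (compress N (opA eta)) (compress N (@opB R)) b (z t, y) ->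
  derivative_at z t y -> coef_ode N eta b z t.
Proof.
move=> zN zy dz k kN.
have := coef_generator_galerkin zN zy kN; rewrite /coef => yE.
have := derivative_at_Im (phi R k) dz; have := derivative_at_Re (phi R k) dz.
rewrite yE => dr di; split.
  by apply: (is_derive_eq dr); case: ham => x x' /=; ring.
by apply: (is_derive_eq di); case: ham => x x' /=; ring.
Qed.

Lemma continuous_mass_sum (D : set R) N z : {within D, continuous z} ->
  {within D, continuous (fun t => \sum_(1 <= k < N.+1) mass k (z t))}.
Proof.
move=> cz.
have cR v : {within D, continuous (fun t => Re (innerL2 v (z t)))}.
  move=> x; apply: (@continuous_comp (subspace D) H R z
    (fun w => Re (innerL2 v w))); first exact: cz.
  exact: Re_inner_continuous.
elim: N => [|N IH] x.
  rewrite (_ : (fun t => _) = cst 0); first exact: cvg_cst.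
  by apply/funext => s; rewrite big_geq.
rewrite (_ : (fun t => _) = (fun t => \sum_(1 <= k < N.+1) mass k (z t) +
   (Re (innerL2 (phi R N.+1) (z t)) * Re (innerL2 (phi R N.+1) (z t)) +
    Re (innerL2 ('i *: phi R N.+1) (z t)) * Re (innerL2 ('i *: phi R N.+1) (z t))))).
  apply: cvgD; first exact: IH.
  by apply: cvgD; apply: cvgM; exact: cR.
by apply/funext => s; rewrite [LHS]big_nat_recr// -Im_innerE -!expr2.
Qed.

End Dynamics.

(** * Growth estimates on an interval of constancy of the control *)

Section IntervalEstimates.
Variable R : realType.
Local Notation H := (L2 R).
Local Notation Re := (@complex.Re R).
Local Notation Im := (@complex.Im R).
Implicit Types (eta b s r t : R) (k m n N : nat) (w : H) (x : R -> H).

(** With [N = m + 2], the coefficient [sqrt (N! / 2) / (N - 2)!] of the bound on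
    the [N]-th tail. *)
Definition tail_const m : R := Num.sqrt ((m.+2)`!%:R / 2) / m`!%:R.

Lemma tail_const_ge0 m : 0 <= tail_const m.
Proof. by rewrite divr_ge0 ?sqrtr_ge0. Qed.

(** The right-hand side arises by differentiating a tail, the left-hand side by
    differentiating the power of its bound. *)
Lemma tail_constS m :
  m.+1%:R * tail_const m.+1 = Num.sqrt m.+3%:R * tail_const m.
Proof.
rewrite /tail_const (factS m.+2) (factS m) !natrM -(mulrA m.+3%:R).
rewrite sqrtrM//; field.
by rewrite nat1r !pnatr_eq0 -!lt0n !fact_gt0.
Qed.

Lemma mass_le_sum N k w : (0 < k <= N)%N ->
  mass k w <= \sum_(1 <= i < N.+1) mass i w.
Proof.
move=> kN; rewrite (bigD1_seq k) ?mem_index_iota ?iota_uniq//=.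
by rewrite lerDl sumr_ge0// => i _; exact: mass_ge0.
Qed.

Lemma continuous_shift_group U w s : unitary_group U ->
  continuous (fun t => U (t - s) w).
Proof.
move=> [_ _ _ _ cU] t.
apply: (@continuous_comp R R H (fun t => t - s) (U^~ w)); last exact: cU.
by apply: cvgB; [exact: cvg_id|exact: cvg_cst].
Qed.

(** By induction on [m]: the mass beyond level [m + 3] is fed only through the
    coefficients [m + 3] and [m + 4], and the former is bounded by the tail at
    the previous level. *)
Lemma tail_growth eta b U w s r (V : R) : unitary_group U ->
  generator U = closure (perturb (opA eta) (@opB R) b) ->
  0 <= V -> Re (innerL2 w w) = 1 ->
  (forall m, Num.sqrt (tail m.+2 w) <= tail_const m * V ^+ m) ->
  forall m t, s <= t <= r -> Num.sqrt (tail m.+2 (U (t - s) w)) <=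
    tail_const m * (V + `|b| * (t - s)) ^+ m.
Proof.
move=> uU gU V0 w1 tw; have [_ isoU U0 _ _] := uU.
elim=> [|m IH] t str.
  rewrite /tail_const !expr0 mulr1 divff// sqrtr1 divr1.
  rewrite -sqrtr1 ler_sqrt// -w1 -(isoU (t - s)) /tail lerBlDr lerDl.
  by rewrite sumr_ge0// => i _; exact: mass_ge0.
move: t str; apply: (sqrt_le_powS_of_derive (f := fun t => tail m.+3 (U (t - s) w))).
- exact: tail_const_ge0.
- by [].
- by [].
- rewrite (_ : (fun t => _) =
    (fun t => 1 - \sum_(1 <= k < m.+4) mass k (U (t - s) w))).
    move=> x; apply: cvgB; first exact: cvg_cst.
    apply: continuous_mass_sum; apply: continuous_subspaceT.
    exact: continuous_shift_group.
  by apply/funext => t; rewrite /tail isoU w1.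
- by move=> t _; exact: tail_ge0.
- move=> t /andP[st tr]; exists (- flux b m.+3 (U (t - s) w)).
    rewrite (_ : (fun t => _) = (cst 1 : R -> R) -
      (fun t => \sum_(1 <= k < m.+4) mass k (U (t - s) w))).
      rewrite -[X in is_derive _ _ _ X]sub0r; apply: is_deriveB.
      by apply: is_derive_mass_sum; exact: unitary_coef_ode gU.
    by apply/funext => u; rewrite /tail isoU w1.
  have st' : 0 <= t - s by rewrite subr_ge0 ltW.
  apply: le_trans (ler_norm _) _; rewrite normrN.
  apply: le_trans (flux_le _ _ _) _.
  rewrite tail_constS; set f := Num.sqrt (tail _ _); set g := _ ^+ m.
  rewrite (_ : 2 * f * _ = 2 * (`|b| * Num.sqrt m.+3%:R) * ((tail_const m * g) * f)).
    rewrite ler_wpM2l ?mulr_ge0 ?sqrtr_ge0// ler_pM ?sqrtr_ge0//.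
      apply: le_trans (IH t _); last by rewrite !ltW.
      by rewrite ler_sqrt ?tail_ge0 ?mass_le_tail.
    by rewrite ler_sqrt ?tail_ge0 ?mass_le_tail.
  by ring.
- by rewrite subrr U0; exact: tw.
Qed.

(** The inner product of a Galerkin solution with any [v - projN N v] is
    constant, as the derivative of the solution lies in the range of [projN N];
    it is then evaluated at [v = x t]. *)
Lemma galerkin_invariant eta b N x s r :
  {within `[s, r], continuous x} ->
  (forall t, s < t < r -> exists2 y,
     perturb (compress N (opA eta)) (compress N (@opB R)) b (x t, y) &
     derivative_at x t y) ->
  projN N (x s) = x s ->
  forall t, s <= t <= r -> projN N (x t) = x t.
Proof.
move=> cx dx xs t /andP[st tr].
suff /eqP : x t - projN N (x t) = 0 by rewrite subr_eq0 => /eqP.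
set v := x t - projN N (x t); apply: nrm0_eq0.
have vP u : innerL2 v (projN N u) = 0 by exact: innerBprojN.
have sub : `[s, t] `<=` `[s, r] by apply: subset_itv; rewrite ?bnd_simp.
have [] := @MVT_segment _ (fun u => Re (innerL2 v (x u))) (fun=> 0) s t st.
- move=> u; rewrite in_itv /= => /andP[su ut].
  have [|y xy dy] := dx u; first by rewrite su (lt_le_trans ut).
  have := derivative_at_Re v dy.
  by rewrite -(galerkin_range xy) vP.
- move=> u; apply: (@continuous_comp (subspace `[s, t]) H R x
    (fun w => Re (innerL2 v w))).
    exact: (continuous_subspaceW sub cx).
  exact: Re_inner_continuous.
- move=> _ _; rewrite mul0r => /eqP; rewrite -xs vP subr0 => /eqP E.
  by rewrite {2}/v innerL2Br vP subr0.
Qed.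

(** The difference of the two solutions obeys the equations of the coefficients
    up to level [N = m + 2].  The Galerkin solution has no coefficient of index
    [N + 1], so the flux through the cut at [N] is controlled by the coefficient
    [N + 1] of the exact solution, hence by its tail. *)
Lemma galerkin_error_growth eta b U w s r (V : R) m x : unitary_group U ->
  generator U = closure (perturb (opA eta) (@opB R) b) ->
  0 <= V -> {within `[s, r], continuous x} ->
  (forall t, s < t < r -> exists2 y,
     perturb (compress m.+2 (opA eta)) (compress m.+2 (@opB R)) b (x t, y) &
     derivative_at x t y) ->
  (forall t, s <= t <= r -> projN m.+2 (x t) = x t) ->
  (forall t, s <= t <= r -> Num.sqrt (tail m.+2 (U (t - s) w)) <=
     tail_const m * (V + `|b| * (t - s)) ^+ m) ->
  nrm (projN m.+2 (x s - w)) <=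
    Num.sqrt m.+2%:R * tail_const m / m.+1%:R * V ^+ m.+1 ->
  forall t, s <= t <= r -> nrm (projN m.+2 (x t - U (t - s) w)) <=
    Num.sqrt m.+2%:R * tail_const m / m.+1%:R * (V + `|b| * (t - s)) ^+ m.+1.
Proof.
move=> uU gU V0 cx dx xN tw xs; have [_ _ U0 _ _] := uU.
pose e t := x t - U (t - s) w.
have K0 : 0 <= Num.sqrt m.+2%:R * tail_const m / m.+1%:R.
  by rewrite divr_ge0// mulr_ge0 ?sqrtr_ge0 ?tail_const_ge0.
move=> t str; rewrite nrm_projN; move: t str.
apply: (sqrt_le_powS_of_derive (f := fun t => \sum_(1 <= k < m.+3) mass k (e t))).
- exact: K0.
- by [].
- by [].
- apply: continuous_mass_sum => u; apply: cvgB; first exact: cx.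
  by apply: (continuous_subspaceT _); exact: continuous_shift_group.
- by move=> t _; rewrite sumr_ge0// => i _; exact: mass_ge0.
- move=> t /[dup] str /andP[st tr]; have [y xy dy] := dx t str.
  have str' : s <= t <= r by rewrite !ltW.
  have xt := xN _ str'.
  exists (flux b m.+2 (e t)).
    apply: is_derive_mass_sum; apply: coef_odeB.
      exact: galerkin_coef_ode xy dy.
    exact: unitary_coef_ode gU.
  apply: le_trans (ler_norm _) _; apply: le_trans (flux_le _ _ _) _.
  set f := Num.sqrt (\sum_(1 <= k < _) _); set g := _ ^+ m.
  rewrite (_ : 2 * f * _ = 2 * (`|b| * Num.sqrt m.+2%:R) * (f * (tail_const m * g))).
    rewrite ler_wpM2l ?mulr_ge0 ?sqrtr_ge0// ler_pM ?sqrtr_ge0//.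
      rewrite ler_sqrt ?mass_le_sum ?leqnn//.
      by rewrite sumr_ge0// => i _; exact: mass_ge0.
    rewrite (_ : mass m.+3 (e t) = mass m.+3 (U (t - s) w)).
      apply: le_trans (tw t str'); rewrite ler_sqrt ?tail_ge0//.
      exact: mass_le_tail.
    rewrite /mass /e coefB -xt coef_projN// ltnn sub0r.
    by case: coef => a a' /=; rewrite !sqrrN.
  by field; rewrite nat1r pnatr_eq0.
- by rewrite /e subrr U0 -nrm_projN.
Qed.

End IntervalEstimates.

(** * The control and its L1 norm *)

Section Control.
Variables (R : realType) (tau a : nat -> R).
Hypothesis htau : nondecreasing_seq tau.
Implicit Types (i j n : nat) (t : R).

Definition partial_L1 j : R := \sum_(0 <= i < j) `|a i| * (tau i.+1 - tau i).

Lemma partial_L1S j :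
  partial_L1 j.+1 = partial_L1 j + `|a j| * (tau j.+1 - tau j).
Proof. by rewrite /partial_L1 big_nat_recr. Qed.

Lemma partial_L1_ge0 j : 0 <= partial_L1 j.
Proof. by rewrite sumr_ge0// => i _; rewrite mulr_ge0// subr_ge0 htau. Qed.

Lemma interval_inj i j t :
  tau i < t < tau i.+1 -> tau j < t < tau j.+1 -> i = j.
Proof.
move=> /andP[it ti] /andP[jt tj]; case: (ltngtP i j) => // ij.
- by have := lt_trans ti (le_lt_trans (htau ij) jt); rewrite ltxx.
- by have := lt_trans tj (le_lt_trans (htau ij) it); rewrite ltxx.
Qed.

Lemma notin_range_tau j t : tau j < t < tau j.+1 -> ~ range tau t.
Proof.
move=> /andP[jt tj] [i _ it]; rewrite -it in jt tj.
have [ij|ji] := leqP i j.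
  by have := lt_le_trans jt (htau ij); rewrite ltxx.
by have := lt_le_trans tj (htau ji); rewrite ltxx.
Qed.

Lemma step_sum_in (c : nat -> R) j t n : tau j < t < tau j.+1 ->
  \sum_(0 <= i < n) c i * \1_(`]tau i, tau i.+1[) t =
  if (j < n)%N then c j else 0.
Proof.
move=> jt; have tj : t \in `]tau j, tau j.+1[%classic.
  by rewrite inE /= in_itv.
have out i : i != j -> c i * \1_(`]tau i, tau i.+1[) t = 0.
  move=> ij; rewrite indicE memNset ?mulr0//= in_itv /= => it.
  by move/eqP: ij; apply; exact: interval_inj it jt.
case: ltnP => jn.
  rewrite (bigD1_seq j) ?mem_index_iota ?iota_uniq//= big1 ?addr0; last exact: out.
  by rewrite indicE tj mulr1.
rewrite big_nat big1// => i /andP[_ ij]; apply: out.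
by rewrite neq_ltn (leq_trans ij jn).
Qed.

Lemma step_sum_out (c : nat -> R) t n : (forall j, ~ (tau j < t < tau j.+1)) ->
  \sum_(0 <= i < n) c i * \1_(`]tau i, tau i.+1[) t = 0.
Proof.
move=> out; rewrite big1// => i _.
by rewrite indicE memNset ?mulr0//= in_itv /=; exact: out.
Qed.

Lemma step_sum_cvg t :
  series (fun j => a j * \1_(`]tau j, tau j.+1[) t) @ \oo --> pwc_control tau a t.
Proof.
suff [l cl] : exists l : R,
    series (fun j => a j * \1_(`]tau j, tau j.+1[) t) @ \oo --> l.
  by rewrite /pwc_control (cvg_lim (@Rhausdorff R) cl).
have [[j jt]|out] := pselect (exists j, tau j < t < tau j.+1).
  exists (a j); apply: cvg_near_cst; exists j.+1 => // n /= jn.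
  by rewrite /series /= (step_sum_in _ _ jt) jn.
exists 0; apply: cvg_near_cst; apply: nearW => n.
by rewrite /series /= step_sum_out// => j jt; apply: out; exists j.
Qed.

Lemma pwc_control_in j t : tau j < t < tau j.+1 -> pwc_control tau a t = a j.
Proof.
move=> jt; apply: (cvg_unique _ (@step_sum_cvg t)) => //.
apply: cvg_near_cst; exists j.+1 => // n /= jn.
by rewrite /series /= (step_sum_in _ _ jt) jn.
Qed.

Lemma measurable_pwc_control :
  measurable_fun [set: measurableTypeR R] (pwc_control tau a).
Proof.
pose h n (t : measurableTypeR R) : R :=
  \sum_(0 <= i < n) a i * \1_(`]tau i, tau i.+1[) t.
have mh n : measurable_fun setT (h n).
  by apply: measurable_sum => i; apply: measurable_funM.
by apply: (measurable_fun_cvg mh) => t _; exact: step_sum_cvg.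
Qed.

Lemma partial_L1_le n :
  ((partial_L1 n)%:E <= 'N[lebR R]_1[EFin \o pwc_control tau a])%E.
Proof.
rewrite Lnorm1.
pose f i (t : measurableTypeR R) : \bar R := (`|a i| * \1_(`]tau i, tau i.+1[) t)%:E.
have mI i : measurable (`]tau i, tau i.+1[ : set (measurableTypeR R)).
  exact: measurable_itv.
have mf i : measurable_fun setT (f i).
  by apply/measurable_EFinP; apply: measurable_funM.
have f0 i t : (0 <= f i t)%E by rewrite lee_fin mulr_ge0.
have fE i : (\int[lebR R]_t f i t)%E = (`|a i| * (tau i.+1 - tau i))%:E.
  under eq_integral do rewrite /f EFinM.
  rewrite ge0_integralZl//; last exact: measurableT_comp.
  have lE : lebR R `]tau i, tau i.+1[%classic = (tau i.+1 - tau i)%:E.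
    apply: etrans (lebesgue_measure_itv `]tau i, tau i.+1[) _; rewrite /= lte_fin.
    case: ltP => // le; apply/esym/eqP.
    by rewrite eqe subr_eq0 eq_le le htau.
  by rewrite integral_indic// setIT lE.
have -> : (partial_L1 n)%:E =
    (\int[lebR R]_t (\sum_(i <- index_iota 0 n) f i t))%E.
  rewrite ge0_integral_sum// /partial_L1 -sumEFin.
  by apply: eq_bigr => i _; rewrite fE.
apply: ge0_le_integral => //.
- by move=> t _; apply: sume_ge0.
- exact: emeasurable_sum.
- apply: measurableT_comp => //; apply/measurable_EFinP.
  exact: measurable_pwc_control.
move=> t _; rewrite /f sumEFin /= lee_fin.
have [[j jt]|out] := pselect (exists j, tau j < t < tau j.+1).
  rewrite (pwc_control_in jt).
  have := step_sum_in (fun i => `|a i|) n jt => ->.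
  by case: ifP.
rewrite step_sum_out// => j jt; apply: out; by exists j.
Qed.

End Control.

(** * Numerical comparison of the bounds *)

Section Constants.
Variable R : realType.
Implicit Types (m n k : nat) (K : R).

Lemma fact_mul_le m n : (m`! * n`! <= (m + n)`!)%N.
Proof.
rewrite -(bin_fact (leq_addr n m)) addKn leq_pmull// bin_gt0.
exact: leq_addr.
Qed.

Lemma expn_le_fact n k m : (n + k <= m)%N -> (n ^ k <= m`!)%N.
Proof.
elim: k m => [|k IH] [|m]; rewrite ?expn0 ?fact_gt0 ?addnS// ltnS => nkm.
rewrite factS expnS leq_mul ?IH//.
by rewrite (leq_trans (leq_addr k n))// leqW.
Qed.

Lemma error_const_le m :
  Num.sqrt m.+2%:R * tail_const R m / m.+1%:R <= Num.sqrt (m.+2)`!%:R / m`!%:R.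
Proof.
rewrite /tail_const mulrA mulrAC ler_pM2r; last by rewrite invr_gt0 ltr0n fact_gt0.
rewrite ler_pdivrMr// -sqrtrM//.
have -> : m.+1%:R = Num.sqrt (m.+1%:R ^+ 2) :> R by rewrite sqrtr_sqr ger0_norm.
rewrite -sqrtrM// ler_sqrt ?mulr_ge0 ?sqr_ge0//.
rewrite mulrCA ler_wpM2l// ler_pdivrMr//.
by rewrite -natrX -natrM ler_nat; lia.
Qed.

Lemma error_bound_le m K : 0 <= K -> (0 < m)%N ->
  Num.sqrt m.+2%:R * tail_const R m / m.+1%:R * K ^+ m.+1 <=
  2 ^+ m.+1 * K ^+ m.+1 / m`!%:R *
    Num.sqrt ((2 * m).+1`!%:R / m.-1`!%:R).
Proof.
move=> K0 m0.
rewrite (_ : 2 ^+ _ * _ / _ * _ = 2 ^+ m.+1 *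
  Num.sqrt ((2 * m).+1`!%:R / m.-1`!%:R) / m`!%:R * K ^+ m.+1); last by ring.
rewrite ler_wpM2r ?exprn_ge0// (le_trans (error_const_le m))//.
rewrite ler_wpM2r ?invr_ge0//.
apply: (@le_trans _ _ (Num.sqrt ((2 * m).+1`!%:R / m.-1`!%:R))); last first.
  by rewrite ler_peMl ?sqrtr_ge0// exprn_ege1// ler1n.
rewrite ler_sqrt ?divr_ge0// ler_pdivlMr ?ltr0n ?fact_gt0//.
rewrite -natrM ler_nat (leq_trans (fact_mul_le _ _))//.
by rewrite (_ : m.+2 + m.-1 = (2 * m).+1)%N//; lia.
Qed.

Lemma K_le4 : pi / 2 * (1 + Num.sqrt 2 / 2) <= 4 :> R.
Proof.
have p2 : pi / 2 < 2 :> R := pihalf_lt2 R.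
have p0 : 0 < pi / 2 :> R by rewrite divr_gt0// pi_gt0.
have s2 : Num.sqrt 2 <= 2 :> R.
  rewrite -[leRHS](ger0_norm (ler0n R 2)) -sqrtr_sqr ler_sqrt ?sqr_ge0//.
  by rewrite expr2; lra.
have s0 : 0 <= Num.sqrt 2 :> R := sqrtr_ge0 _.
by move: (pi / 2) (Num.sqrt 2) p2 p0 s2 s0 => p s *; nra.
Qed.

(** Squaring reduces the claim to
    [16 ^ 419 * 420 * 419 * 10 ^ 8 <= 16 ^ 432 <= 100 ^ 288 <= 418!], where the
    middle inequality is [16 ^ 3 <= 100 ^ 2] raised to the power 144.  The index
    [m] is kept abstract so that its factorial is never computed. *)
Lemma error_bound_420 m K : m = 418%N -> 0 <= K -> K <= 4 ->
  Num.sqrt m.+2%:R * tail_const R m / m.+1%:R * K ^+ m.+1 <= 10 ^- 4.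
Proof.
move=> m418 K0 K4.
apply: le_trans (ler_wpM2r (exprn_ge0 _ K0) (error_const_le m)) _.
have f0 : 0 < m`!%:R :> R by rewrite ltr0n fact_gt0.
rewrite mulrAC ler_pdivrMr// [leRHS]mulrC ler_pdivlMr ?exprn_gt0//.
have h100 : 100 ^+ 318 <= m`!%:R :> R.
  by rewrite -natrX ler_nat expn_le_fact// m418.
have h16 : 16 ^+ m.+1 * (m.+2%:R * m.+1%:R * 10 ^+ 8) <= m`!%:R :> R.
  apply: (le_trans _ h100).
  apply: (@le_trans _ _ (16 ^+ m.+1 * 16 ^+ 12)).
    rewrite ler_wpM2l ?exprn_ge0// m418 !exprS expr0; lra.
  rewrite -exprD (_ : m.+1 + 12 = 431)%N; last by rewrite m418.
  apply: (@le_trans _ _ (16 ^+ (3 * 144))); first by rewrite ler_eXn2l// ltr1n.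
  rewrite exprM; apply: (@le_trans _ _ ((100 ^+ 2) ^+ 144)).
    by rewrite lerXn2r ?nnegrE ?exprn_ge0//; rewrite !exprS expr0; lra.
  by rewrite -exprM ler_eXn2l// ltr1n.
rewrite -(@ler_pXn2r _ 2)// ?nnegrE ?mulr_ge0 ?exprn_ge0 ?sqrtr_ge0//.
rewrite !exprMn sqr_sqrtr// !factS !natrM (exprAC K).
have K16 : (K ^+ 2) ^+ m.+1 <= 16 ^+ m.+1.
  by rewrite lerXn2r ?nnegrE ?exprn_ge0// expr2; nra.
set M := m`!%:R in f0 h100 h16 *.
set A := m.+2%:R in h16 *; set B := m.+1%:R in h16 *.
have AB : 0 <= A * B * 10 ^+ 8 by rewrite !mulr_ge0 ?exprn_ge0.
rewrite (_ : _ * _ = ((K ^+ 2) ^+ m.+1 * (A * B * 10 ^+ 8)) * M); last by ring.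
rewrite [leRHS]expr2 ler_pM2r// (le_trans _ h16)//.
by rewrite ler_wpM2r.
Qed.

End Constants.

(** * From one interval to the half-line *)

Section MainEstimate.
Variables (R : realType) (eta : R) (tau a : nat -> R).
Hypotheses (htau0 : tau 0%N = 0) (htau : nondecreasing_seq tau)
  (htauy : tau @ \oo --> +oo).
Variable Y : R -> L2 R -> L2 R.
Hypothesis hY : schrodinger_propagator eta tau a Y.
Local Notation H := (L2 R).
Local Notation Re := (@complex.Re R).

Lemma tau_ge0 j : 0 <= tau j.
Proof. by rewrite -htau0 htau. Qed.

Lemma exists_interval t : 0 <= t -> exists j, tau j <= t <= tau j.+1.
Proof.
move=> t0; have : exists n, t <= tau n.
  have [n _ Hn] : \forall n \near \oo, t <= tau n.
    by move/cvgryPge : htauy; apply.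
  by exists n; apply: Hn => /=.
move=> ex; case: (ex_minnP ex) => [[|j] tj jmin].
  exists 0%N; rewrite htau0 t0 /=.
  by rewrite (le_trans tj)// htau.
exists j; rewrite tj andbT leNgt; apply/negP => /ltW /jmin.
by rewrite ltnn.
Qed.

(** On the j-th interval, the integral of the absolute value of the control up
    to the time [t]. *)
Let acc j t := partial_L1 tau a j + `|a j| * (t - tau j).

Let acc0 j : acc j (tau j) = partial_L1 tau a j.
Proof. by rewrite /acc subrr mulr0 addr0. Qed.

Let acc1 j : acc j (tau j.+1) = partial_L1 tau a j.+1.
Proof. by rewrite /acc partial_L1S. Qed.

Lemma propagator_iso j v : innerL2 (Y (tau j) v) (Y (tau j) v) = innerL2 v v.
Proof.
have [Y0 Yj] := hY; elim: j => [|j <-]; first by rewrite htau0 Y0.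
have [U [[_ isoU _ _ _] _ YU]] := Yj j.
by rewrite YU ?isoU// lexx htau.
Qed.

(** [tail_growth] on one interval after the other: its bound at the end of an
    interval is its hypothesis at the beginning of the next one. *)
Lemma propagator_tail v j m t :
  Re (innerL2 v v) = 1 -> (forall n, tail n.+3 v = 0) ->
  tau j <= t <= tau j.+1 ->
  Num.sqrt (tail m.+2 (Y t v)) <= tail_const R m * acc j t ^+ m.
Proof.
move=> v1 tv; have [Y0 Yj] := hY.
elim: j m t => [|j IH] m t tj.
  have [U [uU gU YU]] := Yj 0%N; rewrite (YU _ _ tj).
  apply: (tail_growth uU gU (partial_L1_ge0 a htau 0) _ _ m tj).
    by rewrite propagator_iso.
  move=> {}m; rewrite /partial_L1 big_geq// htau0 Y0.
  case: m => [|m]; last by rewrite tv sqrtr0 mulr_ge0 ?tail_const_ge0 ?exprn_ge0.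
  rewrite expr0 mulr1 /tail_const divff// !divr1 sqrtr1 -sqrtr1 ler_sqrt//.
  rewrite /tail v1 lerBlDr lerDl sumr_ge0// => i _; exact: mass_ge0.
have [U [uU gU YU]] := Yj j.+1; rewrite (YU _ _ tj).
apply: (tail_growth uU gU (partial_L1_ge0 a htau j.+1) _ _ m tj).
  by rewrite propagator_iso.
by move=> {}m; rewrite -acc1; apply: IH; rewrite lexx htau.
Qed.

Variables (m : nat) (x : R -> H) (v : H).
Hypothesis hx0 : x 0 = v.
Hypothesis hx :
  solution (galerkin_system eta m.+2 (pwc_control tau a)) (range tau) x.
Hypothesis hv : projN m.+2 v = v.
Hypothesis v1 : Re (innerL2 v v) = 1.
Hypothesis tv : forall n, tail n.+3 v = 0.

Lemma galerkin_on_interval j t : tau j < t < tau j.+1 -> exists2 y,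
  perturb (compress m.+2 (opA eta)) (compress m.+2 (@opB R)) (a j) (x t, y) &
  derivative_at x t y.
Proof.
move=> tj; have [_ dx] := hx.
have [||y] := dx t.
- by case/andP: tj => jt _; exact: le_lt_trans (tau_ge0 j) jt.
- exact: notin_range_tau tj.
- by rewrite /galerkin_system (pwc_control_in a htau tj); exists y.
Qed.

Lemma galerkin_continuous j : {within `[tau j, tau j.+1], continuous x}.
Proof.
have [cx _] := hx; apply: continuous_subspaceW cx.
by apply: subset_itv; rewrite bnd_simp ?tau_ge0.
Qed.

Lemma galerkin_projN j t : tau j <= t <= tau j.+1 -> projN m.+2 (x t) = x t.
Proof.
elim: j t => [|j IH] t tj.
  apply: (galerkin_invariant (@galerkin_continuous 0)
    (@galerkin_on_interval 0) _ tj).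
  by rewrite htau0 hx0.
apply: (galerkin_invariant (@galerkin_continuous _) (@galerkin_on_interval _) _ tj).
by apply: IH; rewrite lexx htau.
Qed.

Lemma galerkin_error j t : tau j <= t <= tau j.+1 ->
  nrm (projN m.+2 (x t - Y t v)) <=
    Num.sqrt m.+2%:R * tail_const R m / m.+1%:R * acc j t ^+ m.+1.
Proof.
have [Y0 Yj] := hY.
suff step k : nrm (projN m.+2 (x (tau k) - Y (tau k) v)) <=
      Num.sqrt m.+2%:R * tail_const R m / m.+1%:R * partial_L1 tau a k ^+ m.+1 ->
    forall t, tau k <= t <= tau k.+1 -> nrm (projN m.+2 (x t - Y t v)) <=
      Num.sqrt m.+2%:R * tail_const R m / m.+1%:R * acc k t ^+ m.+1.
  elim: j t => [|j IH] t; apply: step.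
    rewrite htau0 hx0 Y0 subrr (_ : nrm _ = 0).
      rewrite mulr_ge0 ?exprn_ge0 ?partial_L1_ge0//.
      by rewrite divr_ge0// mulr_ge0 ?sqrtr_ge0 ?tail_const_ge0.
    rewrite nrm_projN big1 ?sqrtr0// => i _.
    by rewrite /mass -(subrr (0 : H)) coefB subrr expr0n addr0.
  by rewrite -acc1; apply: IH; rewrite lexx htau.
move=> xk s sk; have [U [uU gU YU]] := Yj k; rewrite (YU _ _ sk).
apply: (galerkin_error_growth uU gU (partial_L1_ge0 a htau k)
  (@galerkin_continuous k) (@galerkin_on_interval k) (@galerkin_projN k) _ xk sk).
by move=> r rk; rewrite -YU//; exact: propagator_tail.
Qed.

Lemma galerkin_error_K (K t : R) :
  ('N[lebR R]_1[EFin \o pwc_control tau a] <= K%:E)%E -> 0 <= t ->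
  nrm (projN m.+2 (Y t v) - x t) <=
    Num.sqrt m.+2%:R * tail_const R m / m.+1%:R * K ^+ m.+1.
Proof.
move=> hK /exists_interval[j tj].
have -> : nrm (projN m.+2 (Y t v) - x t) = nrm (projN m.+2 (x t - Y t v)).
  rewrite projNB (galerkin_projN tj) -opprB.
  by rewrite /nrm innerL2Nr innerL2Nl opprK.
apply: le_trans (galerkin_error tj) _.
have acc_ge0 : 0 <= acc j t.
  by rewrite addr_ge0 ?partial_L1_ge0// mulr_ge0// subr_ge0; case/andP: tj.
have accK : acc j t <= K.
  apply: (@le_trans _ _ (partial_L1 tau a j.+1)).
    by rewrite -acc1 lerD2l ler_wpM2l// lerD2r; case/andP: tj.
  by rewrite -lee_fin (le_trans (partial_L1_le a htau _)).
have c0 : 0 <= Num.sqrt m.+2%:R * tail_const R m / m.+1%:R.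
  by rewrite divr_ge0// mulr_ge0 ?sqrtr_ge0 ?tail_const_ge0.
by rewrite ler_wpM2l// lerXn2r// nnegrE (le_trans acc_ge0).
Qed.

End MainEstimate.

Theorem mainTheorem1 (R : realType) (eta : R) (heta : 0 < eta)
    (K : R) (hK : K = pi / 2 * (1 + Num.sqrt 2 / 2))
    (tau a : nat -> R) (htau0 : tau 0%N = 0) (htau : nondecreasing_seq tau)
    (htauy : tau @ \oo --> +oo)
    (hu : ('N[lebR R]_1[EFin \o pwc_control tau a] <= K%:E)%E)
    (Y : R -> L2 R -> L2 R) (hY : schrodinger_propagator eta tau a Y)
    (X : nat -> R -> R -> L2 R -> L2 R)
    (hX : forall N, (1 <= N)%N -> linear_propagator
       (galerkin_system eta N (pwc_control tau a)) (range tau) (X N)) :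
  (forall (N : nat) (t : R) (j : nat), (3 <= N)%N -> 0 <= t ->
     (1 <= j <= 3)%N ->
     `|projN N (Y t (phi R j)) - X N t 0 (phi R j)| <=
       (2 ^+ (N - 1) * K ^+ (N - 1) / (N - 2)`!%:R *
        Num.sqrt ((2 * N - 3)`!%:R / (N - 3)`!%:R))%:C)
  /\
  (forall (t : R) (j : nat), 0 <= t -> (1 <= j <= 3)%N ->
     `|projN 420 (Y t (phi R j)) - X 420%N t 0 (phi R j)| <= (10 ^- 4)%:C).

Proof.
have K0 : 0 <= K.
  by rewrite hK mulr_ge0 ?addr_ge0 ?divr_ge0 ?sqrtr_ge0 ?pi_ge0.
have K4 : K <= 4 by rewrite hK; exact: K_le4.
have err m t j : (0 < m)%N -> 0 <= t -> (1 <= j <= 3)%N ->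
    `|projN m.+2 (Y t (phi R j)) - X m.+2 t 0 (phi R j)| <=
    (Num.sqrt m.+2%:R * tail_const R m / m.+1%:R * K ^+ m.+1)%:C.
  move=> m0 t0 /andP[j0 j3]; have [X0 hx] := hX m.+2 isT 0 (phi R j) (lexx 0).
  rewrite normE lecR.
  apply: (galerkin_error_K htau0 htau htauy hY X0 hx) hu t0.
  - by rewrite projN_phi// j0 (leq_trans j3).
  - by rewrite innerL2_phi// eqxx.
  - by move=> n; rewrite tail_phi// j0 (leq_trans j3).
split=> [N t j N3 t0 j3 | t j t0 j3].
  case: N N3 => [|[|[|m]]] // _.
  apply: le_trans (err m.+1 t j isT t0 j3) _; rewrite lecR.
  rewrite (_ : m.+3 - 1 = m.+2)%N// (_ : m.+3 - 2 = m.+1)%N//.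
  rewrite (_ : m.+3 - 3 = m.+1.-1)%N; last by lia.
  rewrite (_ : 2 * m.+3 - 3 = (2 * m.+1).+1)%N; last by lia.
  exact: error_bound_le.
have H n : n = 418%N ->
    `|projN n.+2 (Y t (phi R j)) - X n.+2 t 0 (phi R j)| <= (10 ^- 4)%:C.
  move=> n418; have n0 : (0 < n)%N by rewrite n418.
  apply: le_trans (err n t j n0 t0 j3) _.
  by rewrite lecR error_bound_420.
exact: (H 418%N erefl).
Qed.
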